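(* Let $\varphi$ be a strictly increasing and strictly concave function on $[0,2\pi]$ with $\varphi(0)=0$. Then every inner function is an extreme point of the unit ball of the Hardy-Lorentz space $H(\Lambda(\varphi))$.
   Context: $\mathbb{D}$ is the open unit disc in $\mathbb{C}$ and $\mathbb{T}$ its boundary circle, with arc-length (Lebesgue) measure $m$, $m(\mathbb{T})=2\pi$; functions on $\mathbb{T}$ are identified when equal a.e. For measurable $f\colon\mathbb{T}\to\mathbb{C}$, $f^*$ denotes the decreasing rearrangement of $f$ on $[0,2\pi]$: $f^*(t)=\inf\{s\ge 0: m(\{|f|>s\})\le t\}$. For $\varphi\colon[0,2\pi]\to\mathbb{R}$ increasing and concave with $\varphi(0)=0$, the Lorentz space $\Lambda(\varphi)$ is the set of all measurable $f\colon\mathbb{T}\to\mathbb{C}$ such that $\|f\|_{\Lambda(\varphi)}:=\int_0^{2\pi}f^*(t)\varphi'(t)\,dt<\infty$. The Hardy-Lorentz space $H(\Lambda(\varphi))$ is the set of all analytic functions $f\colon\mathbb{D}\to\mathbb{C}$ such that $\|f\|_{H(\Lambda(\varphi))}:=\sup_{0\le r<1}\|f_r\|_{\Lambda(\varphi)}<\infty$, where $f_r(e^{i\theta}):=f(re^{i\theta})$ for $0\le r<1$ and $\theta\in[0,2\pi]$. Since $H(\Lambda(\varphi))$ is contained in the Hardy space $H^1(\mathbb{D})$, such functions have boundary values a.e. on $\mathbb{T}$, still denoted $f$. The unit ball of $H(\Lambda(\varphi))$ is the set of $f$ with $\|f\|_{H(\Lambda(\varphi))}\le 1$. An inner function is a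 bounded analytic function $f$ on $\mathbb{D}$ whose boundary values satisfy $|f(e^{i\theta})|=1$ for a.e. $e^{i\theta}\in\mathbb{T}$.
   Formalization: Every inner function f has norm φ(2π) − φ(0+), which need not be 1, so the claim is proved for f divided by its norm in H(Λ(φ)); when that norm is 1, this is f itself being an extreme point. *)

(* Defs.v *)
From HB Require Import structures.
From mathcomp Require Import all_boot all_order all_algebra.
From mathcomp Require Import complex.
From mathcomp Require Import all_classical all_reals all_analysis.

Set Implicit Arguments.
Unset Strict Implicit.
Unset Printing Implicit Defensive.

Import Order.TTheory GRing.Theory Num.Theory.
Import numFieldNormedType.Exports.

Local Open Scope classical_set_scope.
Local Open Scope ring_scope.
Local Open Scope complex_scope.

(* The norm `|z| of R[i] is itself an element of R[i], with zero imaginary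
   part; cmod is the modulus as an element of R. *)
Definition cmod (R : realType) (z : R[i]) : R := complex.Re `|z|.

Definition disc (R : realType) : set R[i] := [set z | cmod z < 1].

Definition expi (R : realType) (t : R) : R[i] := cos t +i* sin t.

(* Functions on the disc, or on the circle, are represented by total functions
   R[i] -> R[i] whose values elsewhere are irrelevant. *)
Definition analytic_on (R : realType) (U : set R[i]) (f : R[i] -> R[i]) : Prop :=
  forall z0, U z0 -> exists r : R, 0 < r /\ exists a : nat -> R[i],
    forall z, cmod (z - z0) < r ->
      [series (a k * (z - z0) ^+ k : R[i]^o)]_k @ \oo --> (f z : R[i]^o).

Definition arc_length (R : realType) (A : set R[i]) : \bar R :=
  lebesgue_measure [set t : R | 0 <= t < 2 * pi /\ A (expi t)].

Definition rearrangement (R : realType) (f : R[i] -> R[i]) (t : R) : \bar R :=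
  ereal_inf [set s%:E | s in
    [set s : R | 0 <= s /\ (arc_length [set z | (s < cmod (f z))%R] <= t%:E)%E]].

Definition strictly_concave_on (R : realType) (I : set R) (phi : R -> R) : Prop :=
  forall x y t : R, I x -> I y -> x != y -> 0 < t < 1 ->
    t * phi x + (1 - t) * phi y < phi (t * x + (1 - t) * y).

(* For concave phi the derivative exists off a countable set, so its
   conventional values elsewhere do not affect the integral. *)
Definition lorentz_norm (R : realType) (phi : R -> R) (f : R[i] -> R[i]) : \bar R :=
  (\int[lebesgue_measure]_(t in (`[0%R, (2 * pi)%R] : set R))
     (rearrangement f t * (derive1 (phi : R -> R^o) t)%:E))%E.

Definition dilate (R : realType) (f : R[i] -> R[i]) (r : R) : R[i] -> R[i] :=
  fun z => f (r%:C * z).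

Definition hardy_lorentz_norm (R : realType) (phi : R -> R) (f : R[i] -> R[i]) :
    \bar R :=
  ereal_sup [set lorentz_norm phi (dilate f r) | r in [set r : R | 0 <= r < 1]].

(* Measurability of the dilates on the circle is automatic, since they are
   continuous there. *)
Definition hardy_lorentz (R : realType) (phi : R -> R) : set (R[i] -> R[i]) :=
  [set f | analytic_on (@disc R) f /\ (hardy_lorentz_norm phi f < +oo)%E].

Definition hardy_lorentz_ball (R : realType) (phi : R -> R) :
    set (R[i] -> R[i]) :=
  [set f | hardy_lorentz phi f /\ (hardy_lorentz_norm phi f <= 1)%E].

(* Boundary values are radial limits. *)
Definition boundary_value (R : realType) (f : R[i] -> R[i]) (zeta w : R[i]) : Prop :=
  f (r%:C * zeta) @[r --> (1 : R)^'-] --> (w : R[i]^o).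

Definition inner_function (R : realType) (f : R[i] -> R[i]) : Prop :=
  [/\ analytic_on (@disc R) f,
      exists M : R, forall z, disc z -> cmod (f z) <= M
    & {ae lebesgue_measure, forall t : R, 0 <= t < 2 * pi ->
        exists w, boundary_value f (expi t) w /\ cmod w = 1}].

(* Extreme points of a set of functions on the disc; accordingly, equality of
   functions is equality on the disc. *)
Definition extreme_point (R : realType) (E : set (R[i] -> R[i]))
    (f : R[i] -> R[i]) : Prop :=
  E f /\ forall (g h : R[i] -> R[i]) (t : R), E g -> E h -> 0 < t < 1 ->
    (forall z, disc z -> f z = t%:C * g z + (1 - t)%:C * h z) ->
    forall z, disc z -> g z = f z /\ h z = f z.

(* An inner function has norm phi(2 pi) - phi(0+), which is 1 only under a
   normalization of phi; in general it is f / ||f|| that lies on the unit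
   sphere. *)
Definition normalized (R : realType) (phi : R -> R) (f : R[i] -> R[i]) :
    R[i] -> R[i] :=
  fun z => ((fine (hardy_lorentz_norm phi f))^-1)%:C * f z.

Lemma normalized_id (R : realType) (phi : R -> R) (f : R[i] -> R[i]) :
  hardy_lorentz_norm phi f = 1%E -> normalized phi f = f.
Proof. by move=> f1; apply/funext => z; rewrite /normalized f1 /= invr1 mul1r. Qed.

(* Main.v *)
Require Import Defs.
From HB Require Import structures.
From mathcomp Require Import all_boot all_order all_algebra.
From mathcomp Require Import complex.
From mathcomp Require Import all_classical all_reals all_analysis measurable_realfun.
From mathcomp Require Import ring lra zify.
Import Order.TTheory GRing.Theory Num.Theory.
Import numFieldNormedType.Exports.
Local Open Scope classical_set_scope.
Local Open Scope ring_scope.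
Import ComplexField.Normc.
Local Open Scope complex_scope.

(** Let c be the integral of phi' over (0, 2 pi) and let L = 2 pi.  As phi' is
    decreasing, the Lorentz norm dominates (c / L) times the L^1 norm, and by
    strict concavity equality forces the modulus to be constant.  Both facts
    are read off the layer-cake formula
      ||v|| = int_0^oo W (d s) ds,   W x = int_0^x phi',
    where d s is the measure of the set where v exceeds s: the concave
    function W lies above its chord on [0, L], by at least
    kappa * min x (L - x) with kappa > 0 ([primitive_gap]), and
    int_0^oo min (d s) (L - d s) ds controls the L^1 distance from v to a
    constant.  Quantitatively ([lorentz_stability]), a function v >= 0 of
    norm at most 1 satisfies int v <= L / c and
      int |v - 1/c| <= K (L / c - int v).

    An inner function f has modulus at most 1 in the disc ([inner_le1]) and its
    L^1 norms over circles tend to 2 pi, so its norm is c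
    ([inner_hardy_lorentz_norm]) and f / c is in the unit ball.

    Suppose that f / c = t g + (1 - t) h with g and h in the unit ball.  Then
    |f| / c <= t |g| + (1 - t) |h|, and on the circle of radius r the integrals
    of |g| and |h| are at most L / c while that of |f| / c tends to L / c as r
    tends to 1.  Hence those of |g| and |h| also tend to L / c, and by
    stability |g| and |h| approach the constant 1/c in L^1.  The defect
    t |g| + (1 - t) |h| - |t g + (1 - t) h| has integrals tending to 0 as well, so
    g and h have nearly the same argument ([convexity_defect]).  Together these
    give int |g - h| -> 0 on circles, and g = h by Cauchy's estimate
    ([cauchy_estimate]).  All of this takes place on circles of radius
    less than 1.

    Complex analysis enters only through Cauchy's estimate.  A local power
    series is strictly differentiable at its centre, hence an analytic
    function is continuously differentiable; this suffices to
    differentiate the Cauchy integral along the homotopy that shrinks the circle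
    to a point. *)

(** * Modulus *)

Section Modulus.
Context {R : realType}.
Implicit Types (z w : R[i]) (x y : R).

Lemma normc_cmod z : `|z| = (cmod z)%:C. Proof. by []. Qed.

Lemma cmod_sqrt x y : cmod (x +i* y) = Num.sqrt (x ^+ 2 + y ^+ 2).
Proof. by []. Qed.

Lemma cmod_ge0 z : 0 <= cmod z.
Proof. by case: z => a b; exact: sqrtr_ge0. Qed.

Lemma cmodM z w : cmod (z * w) = cmod z * cmod w.
Proof. exact: normcM. Qed.

Lemma cmodV z : cmod z^-1 = (cmod z)^-1.
Proof. exact: normcV. Qed.

Lemma cmodD z w : cmod (z + w) <= cmod z + cmod w.
Proof. by have := ler_normD z w; rewrite !normc_cmod -rmorphD /= lecR. Qed.

Lemma cmodN z : cmod (- z) = cmod z.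
Proof. by rewrite /cmod normrN. Qed.

Lemma cmodBC z w : cmod (z - w) = cmod (w - z).
Proof. by rewrite -cmodN opprB. Qed.

Lemma cmodB z w : cmod (z - w) <= cmod z + cmod w.
Proof. by rewrite -(cmodN w) cmodD. Qed.

Lemma cmodB_ge z w : cmod z - cmod w <= cmod (z - w).
Proof. by rewrite lerBlDr -{1}(subrK w z) cmodD. Qed.

Lemma cmod_distr z w : `|cmod z - cmod w| <= cmod (z - w).
Proof. by rewrite ler_norml lerNl opprB {1}cmodBC !cmodB_ge. Qed.

Lemma cmod0 : cmod (0 : R[i]) = 0.
Proof. by rewrite /cmod normr0. Qed.

Lemma cmod1 : cmod (1 : R[i]) = 1.
Proof. by rewrite /cmod normr1. Qed.

Lemma cmod0_eq0 z : cmod z = 0 -> z = 0.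
Proof. exact: eq0_normc. Qed.

Lemma cmod_gt0 z : z != 0 -> 0 < cmod z.
Proof.
by move=> z0; rewrite lt_neqAle cmod_ge0 andbT eq_sym; apply: contra_neq z0 => /cmod0_eq0.
Qed.

Lemma cmodX z n : cmod (z ^+ n) = cmod z ^+ n.
Proof.
by elim: n => [|n ih]; rewrite ?expr0 ?cmod1// !exprS cmodM ih.
Qed.

Lemma cmodR x : cmod x%:C = `|x|.
Proof. by rewrite /cmod /= expr0n /= addr0 sqrtr_sqr. Qed.

Lemma cmod_sum (I : Type) (s : seq I) (P : pred I) (F : I -> R[i]) :
  cmod (\sum_(i <- s | P i) F i) <= \sum_(i <- s | P i) cmod (F i).
Proof.
elim/big_ind2 : _ => [|a b c d ab cd|//]; first by rewrite cmod0.
exact: le_trans (cmodD _ _) (lerD ab cd).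
Qed.

Lemma Re_le_cmod z : `|complex.Re z| <= cmod z.
Proof.
case: z => a b /=; rewrite cmod_sqrt -(sqrtr_sqr a).
by apply: ler_wsqrtr; rewrite lerDl sqr_ge0.
Qed.

Lemma Im_le_cmod z : `|complex.Im z| <= cmod z.
Proof.
case: z => a b /=; rewrite cmod_sqrt -(sqrtr_sqr b).
by apply: ler_wsqrtr; rewrite lerDr sqr_ge0.
Qed.

Lemma cmod_le_ReIm z : cmod z <= `|complex.Re z| + `|complex.Im z|.
Proof.
case: z => a b /=; rewrite cmod_sqrt.
rewrite -[leRHS]ger0_norm ?addr_ge0// -sqrtr_sqr.
apply: ler_wsqrtr; rewrite sqrrD !real_normK ?num_real//.
by rewrite -addrA lerD2l lerDr mulrn_wge0// mulr_ge0.
Qed.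

Lemma cmod_expi x : cmod (expi x) = 1.
Proof. by rewrite cmod_sqrt cos2Dsin2 sqrtr1. Qed.

End Modulus.

(** * Strict derivatives of analytic functions *)

Section StrictDerivative.
Context {R : realType}.
Implicit Types (z w : R[i]) (x y : R) (u v : R[i] -> R[i]).

(** Strictness, that is two moving points instead of one, costs nothing for a
    power series, and it makes the derivative continuous wherever
    it exists on a neighbourhood. *)
Definition strict_deriv u z0 (a : R[i]) := forall e : R, 0 < e ->
  exists2 delta : R, 0 < delta & forall z z',
    cmod (z - z0) < delta -> cmod (z' - z0) < delta ->
    cmod (u z' - u z - a * (z' - z)) <= e * cmod (z' - z).

Lemma cvg_cmod (s : nat -> R[i]^o) (l : R[i]^o) :
  s @ \oo --> l ->
  forall e : R, 0 < e -> exists N, forall n, (N <= n)%N -> cmod (s n - l) <= e.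
Proof.
move=> /(@cvgrPdist_le _ R[i]^o _ _ _ s l) sl e e0.
have e0' : 0 < e%:C by rewrite ltcR.
have [N _ H] := sl _ e0'; exists N => n /H /=.
by rewrite normc_cmod lecR cmodBC.
Qed.

(** The terms of a convergent series are bounded; this Cauchy bound is all that
    is kept of the convergence. *)
Lemma powerseries_bounded (a : nat -> R[i]) (r : R) (v : R[i] -> R[i]) :
  0 < r -> [series (a k * r%:C ^+ k : R[i]^o)]_k @ \oo --> (v r%:C : R[i]^o) ->
  exists2 M : R, 0 < M & forall k, cmod (a k) * r ^+ k <= M.
Proof.
move=> r0 /cvg_cmod/(_ 1 ltr01)[N HN].
pose t k := cmod (a k) * r ^+ k.
have t0 k : 0 <= t k by rewrite mulr_ge0 ?cmod_ge0// exprn_ge0// ltW.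
exists (2 + \sum_(i < N) t i) => [|k]; first by rewrite ltr_wpDr ?sumr_ge0.
have [kN|Nk] := ltnP k N.
  rewrite (bigD1 (Ordinal kN))//= -/(t k).
  have : 0 <= \sum_(i < N | i != Ordinal kN) t i by rewrite sumr_ge0.
  lra.
have -> : cmod (a k) * r ^+ k = cmod (a k * r%:C ^+ k).
  by rewrite cmodM cmodX cmodR gtr0_norm.
have -> : a k * r%:C ^+ k = ([series (a k * r%:C ^+ k : R[i]^o)]_k k.+1 - v r%:C)
    - ([series (a k * r%:C ^+ k : R[i]^o)]_k k - v r%:C) .
  rewrite /series /= big_nat_recr //=.
  by rewrite opprB addrA subrK addrC addKr.
have := cmodB ([series (a k * r%:C ^+ k : R[i]^o)]_k k.+1 - v r%:C) 
  ([series (a k * r%:C ^+ k : R[i]^o)]_k k - v r%:C).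
have := HN _ (leqW Nk); have := HN _ Nk.
have : 0 <= \sum_(i < N) t i by rewrite sumr_ge0.
lra.
Qed.

Lemma cmod_subXX z z' (m : R) k : cmod z <= m -> cmod z' <= m ->
  cmod (z' ^+ k - z ^+ k) <= k%:R * m ^+ k.-1 * cmod (z' - z).
Proof.
move=> zm z'm; rewrite subrXX cmodM mulrC ler_wpM2r ?cmod_ge0//.
apply: le_trans (cmod_sum _ _ _ _) _.
rewrite mulr_natl -[k in _ *+ k]card_ord -sumr_const.
apply: ler_sum => i _; rewrite cmodM !cmodX.
have -> : k.-1 = (k.-1 - i + i)%N by rewrite subnK// -ltnS prednK// (leq_trans _ (ltn_ord i)).
rewrite exprD addnK -subn1 subnAC subn1 -subnS.
by rewrite ler_pM ?exprn_ge0 ?cmod_ge0// lerXn2r ?nnegrE ?cmod_ge0// (le_trans _ zm)// cmod_ge0.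
Qed.


(** With |a k| rho^k <= M, and both points within rho * q of the centre, the
    terms of degree at least 2 of the difference quotient add up to O(q), so the
    linear term a 1 dominates.  The estimate is made on the partial sums, uniformly
    in their length, and passes to the limit. *)
Lemma powerseries_strict_deriv (v : R[i] -> R[i]) z0 (a : nat -> R[i]) (r : R) :
  0 < r ->
  (forall z, cmod (z - z0) < r ->
     [series (a k * (z - z0) ^+ k : R[i]^o)]_k @ \oo --> (v z : R[i]^o)) ->
  strict_deriv v z0 (a 1%N).
Proof.
move=> r0 Hv.
pose rho := r / 2.
have rho0 : 0 < rho by rewrite divr_gt0.
have [M M0 aM] : exists2 M : R, 0 < M & forall k, cmod (a k) * rho ^+ k <= M.
  apply: (@powerseries_bounded a rho (fun z => v (z + z0))) => //.
  have := Hv (rho%:C + z0); rewrite addrK; apply.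
  by rewrite cmodR gtr0_norm// /rho; lra.
move=> e e0.
pose q := Num.min 4^-1 (e * rho / (32 * M)).
have q0 : 0 < q by rewrite lt_min invr_gt0 ltr0n/= divr_gt0 ?mulr_gt0.
have q4 : q <= 4^-1 by rewrite ge_min lexx.
have qe : q * (32 * M) <= e * rho.
  by rewrite -ler_pdivlMr ?mulr_gt0// ge_min lexx orbT.
exists (rho * q); first exact: mulr_gt0.
move=> z z' zq z'q.
have qr : rho * q < r by rewrite /rho; nra.
have Hz := Hv _ (lt_trans zq qr); have Hz' := Hv _ (lt_trans z'q qr).
set D := z' - z.
(* One factor q is set aside: it makes the sum small.  The remaining power
   q^(k-2) <= 4^-(k-2) beats the factor k and leaves a ratio of 1/2. *)
have term k : (2 <= k)%N ->
    cmod (a k * ((z' - z0) ^+ k - (z - z0) ^+ k)) <=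
    M / rho * q * 16 * cmod D * (2^-1) ^+ k.
  move=> k2; rewrite cmodM.
  have := @cmod_subXX (z - z0) (z' - z0) (rho * q) k (ltW zq) (ltW z'q).
  have -> : z' - z0 - (z - z0) = D by rewrite /D opprB addrA subrK.
  move/(ler_wpM2l (cmod_ge0 (a k)))/le_trans; apply.
  have -> : cmod (a k) * (k%:R * (rho * q) ^+ k.-1 * cmod D) =
     cmod (a k) * rho ^+ k * (rho^-1 * q * cmod D) * (k%:R * q ^+ k.-2).
    have [j ->] : exists j, k = j.+2 by case: k k2 => [|[|j]]// _; exists j.
    rewrite /= !exprSr exprMn.
    by field; rewrite gt_eqF.
  have -> : M / rho * q * 16 * cmod D * (2^-1) ^+ k =
     M * (rho^-1 * q * cmod D) * (16 * (2^-1) ^+ k) by ring.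
  have kq : k%:R * q ^+ k.-2 <= 16 * (2^-1) ^+ k.
    have [j ->] : exists j, k = j.+2 by case: k k2 => [|[|j]]// _; exists j.
    rewrite /=.
    have : j.+2%:R <= 4 * 2 ^+ j :> R.
      by rewrite -natrX -natrM ler_nat; have := ltn_expl j (isT : 1 < 2)%N; lia.
    have qj : q ^+ j <= (4^-1) ^+ j by rewrite lerXn2r ?nnegrE ?invr_ge0// ltW.
    move=> /ler_pM /(_ qj) H; apply: le_trans (H _ _) _.
    - by [].
    - by rewrite exprn_ge0// ltW.
    have -> : (4^-1 : R) = 2^-1 * 2^-1 by lra.
    rewrite exprMn !exprSr; set b := 2^-1 ^+ j.
    have b1 : 2 ^+ j * b = 1 by rewrite /b -exprMn mulfV// expr1n.
    have -> : 4 * 2 ^+ j * (b * b) = 4 * b * (2 ^+ j * b) by ring.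
    rewrite b1; lra.
  apply: ler_pM => //.
  - by rewrite mulr_ge0 ?mulr_ge0 ?cmod_ge0 ?exprn_ge0 ?invr_ge0// ltW.
  - by rewrite mulr_ge0 ?exprn_ge0// ltW.
  apply: ler_wpM2r => //; rewrite mulr_ge0 ?cmod_ge0// mulr_ge0 ?invr_ge0 ?ltW//.
pose S (y : R[i]) n : R[i] := [series (a k * (y - z0) ^+ k : R[i]^o)]_k n.
have part n : cmod (S z' n.+2 - S z n.+2 - a 1%N * D) <= e * cmod D.
  rewrite /S /series /= !(big_ltn (_ : 0 < n.+2)%N)// !(big_ltn (_ : 1 < n.+2)%N)//.
  rewrite !expr0 !expr1.
  set A := \sum_(2 <= k < n.+2) _; set B := \sum_(2 <= k < n.+2) _.
  have -> : a 0%N * 1 + (a 1%N * (z' - z0) + A) - (a 0%N * 1 + (a 1%N * (z - z0) + B))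
    - a 1%N * D = A - B by rewrite /D; ring.
  rewrite /A /B -sumrB; apply: le_trans (cmod_sum _ _ _ _) _.
  apply: (@le_trans _ _ (\sum_(2 <= k < n.+2) M / rho * q * 16 * cmod D * (2^-1) ^+ k)).
    rewrite !big_nat; apply: ler_sum => k /andP[k2 _].
    by rewrite -mulrBr; exact: term.
  rewrite -mulr_sumr.
  have geo : \sum_(2 <= k < n.+2) (2^-1 : R) ^+ k <= 2^-1 - (2^-1) ^+ n.+1.
    elim: n {A B} => [|n ih]; first by rewrite big_geq// expr1 subrr.
    rewrite big_nat_recr//=; apply: le_trans (lerD ih (lexx _)) _.
    rewrite [_ ^+ n.+2]exprSr; lra.
  have geo2 : \sum_(2 <= k < n.+2) (2^-1 : R) ^+ k <= 2^-1.
    by apply: le_trans geo _; rewrite gerBl exprn_ge0.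
  apply: (@le_trans _ _ (M / rho * q * 16 * cmod D * 2^-1)).
    apply: ler_wpM2l => //.
    by rewrite !mulr_ge0 ?cmod_ge0 ?invr_ge0// ltW.
  have -> : M / rho * q * 16 * cmod D * 2^-1 = (q * (32 * M)) / (4 * rho) * cmod D.
    by field; rewrite gt_eqF.
  apply: ler_wpM2r; first exact: cmod_ge0.
  rewrite ler_pdivrMr ?mulr_gt0//; apply: le_trans qe _.
  have : 0 <= e * rho by rewrite mulr_ge0 ?ltW.
  lra.
apply/ler_addgt0Pr => eta eta0.
have eta2 : 0 < eta / 2 by rewrite divr_gt0.
have [N1 HN1] := cvg_cmod _ _ Hz _ eta2.
have [N2 HN2] := cvg_cmod _ _ Hz' _ eta2.
pose n := (N1 + N2)%N.
have h1 : cmod (S z n.+2 - v z) <= eta / 2.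
  by apply: HN1; do 2!apply: leqW; exact: leq_addr.
have h2 : cmod (S z' n.+2 - v z') <= eta / 2.
  by apply: HN2; do 2!apply: leqW; exact: leq_addl.
have E (A B A' B' C : R[i]) : A' - A - C = (B' - B - C) + ((B - A) - (B' - A')).
  by ring.
rewrite (E _ (S z n.+2) _ (S z' n.+2)).
apply: le_trans (cmodD _ _) _; apply: lerD; first exact: part.
by apply: le_trans (cmodB _ _) _; lra.
Qed.

Lemma analytic_strict_deriv (f : R[i] -> R[i]) :
  analytic_on (@disc R) f -> forall z, disc z -> exists a, strict_deriv f z a.
Proof.
move=> fa z /fa[r [r0 [a Ha]]].
by exists (a 1%N); exact: powerseries_strict_deriv r0 Ha.
Qed.

End StrictDerivative.

(** * Holomorphic functions and paths *)

Section Calculus.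
Context {R : realType}.
Implicit Types (z w : R[i]) (x y : R) (u v : R[i] -> R[i]).

(** Continuity in terms of the real-valued modulus, so that it can be composed
    with real functions of real variables. *)
Definition ccontinuous u z0 := forall e : R, 0 < e ->
  exists2 delta : R, 0 < delta & forall z, cmod (z - z0) < delta ->
    cmod (u z - u z0) <= e.

Lemma strict_deriv_continuous u z0 a : strict_deriv u z0 a -> ccontinuous u z0.
Proof.
move=> ua e e0; have [d d0 H] := ua _ ltr01.
exists (Num.min d (e / (1 + cmod a))).
  by rewrite lt_min d0 divr_gt0// ltr_pwDl// cmod_ge0.
move=> z; rewrite lt_min ltr_pdivlMr ?ltr_pwDl ?cmod_ge0// => /andP[zd zea].
have := H z0 z; rewrite subrr cmod0 => /(_ d0 zd) K.
have -> : u z - u z0 = (u z - u z0 - a * (z - z0)) + a * (z - z0) by rewrite subrK.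
apply: le_trans (cmodD _ _) _; rewrite cmodM.
apply: le_trans (lerD K (lexx _)) _.
by rewrite -mulrDl mulrC ltW.
Qed.

Lemma strict_deriv_cst c z0 : strict_deriv (fun=> c) z0 0.
Proof.
move=> e e0; exists 1 => // z z' _ _.
by rewrite subrr mul0r subrr cmod0 mulr_ge0 ?cmod_ge0// ltW.
Qed.

Lemma strict_derivB u v z0 a b : strict_deriv u z0 a -> strict_deriv v z0 b ->
  strict_deriv (fun z => u z - v z) z0 (a - b).
Proof.
move=> ua vb e e0; have e2 : 0 < e / 2 by rewrite divr_gt0.
have [d1 d10 H1] := ua _ e2; have [d2 d20 H2] := vb _ e2.
exists (Num.min d1 d2); first by rewrite lt_min d10.
move=> z z'; rewrite !lt_min => /andP[z1 z2] /andP[z'1 z'2].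
have E (A B A' B' C : R[i]) : A' - B' - (A - B) - (a - b) * C =
  (A' - A - a * C) - (B' - B - b * C) by ring.
rewrite E; apply: le_trans (cmodB _ _) _.
have := H1 _ _ z1 z'1; have := H2 _ _ z2 z'2; lra.
Qed.

(** Product rule: the increment of u v splits into four terms, each carrying one
    small factor. *)
Lemma strict_derivM u v z0 a b : strict_deriv u z0 a -> strict_deriv v z0 b ->
  strict_deriv (fun z => u z * v z) z0 (a * v z0 + u z0 * b).
Proof.
move=> ua vb e e0.
have cu := strict_deriv_continuous _ _ _ ua.
have cv := strict_deriv_continuous _ _ _ vb.
pose K := cmod (v z0) + cmod (u z0) + cmod a + cmod b + 3.
have K0 : 0 < K by rewrite ltr_wpDl// !addr_ge0 ?cmod_ge0.
pose e' := Num.min 1 (e / K).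
have e'0 : 0 < e' by rewrite lt_min ltr01 divr_gt0.
have e'1 : e' <= 1 by rewrite ge_min lexx.
have e'K : e' * K <= e by rewrite -ler_pdivlMr// ge_min lexx orbT.
have [d1 d10 H1] := ua _ e'0; have [d2 d20 H2] := vb _ e'0.
have [d3 d30 H3] := cu _ e'0; have [d4 d40 H4] := cv _ e'0.
exists (Num.min (Num.min d1 d2) (Num.min d3 d4)); first by rewrite !lt_min d10 d20 d30.
move=> z z'; rewrite !lt_min => /andP[/andP[z1 z2] /andP[z3 z4]].
move=> /andP[/andP[z'1 z'2] /andP[z'3 z'4]].
have E (A A' B B' U V C : R[i]) : A' * B' - A * B - (a * V + U * b) * C =
  ((A' - A - a * C) * B' + a * C * (B' - V)) +
  (A * (B' - B - b * C) + (A - U) * (b * C)) by ring.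
rewrite E.
set C := z' - z.
have vz' : cmod (v z') <= cmod (v z0) + 1.
  by rewrite -(subrK (v z0) (v z')) addrC (le_trans (cmodD _ _))// lerD2l (le_trans (H4 _ z'4)).
have uz : cmod (u z) <= cmod (u z0) + 1.
  by rewrite -(subrK (u z0) (u z)) addrC (le_trans (cmodD _ _))// lerD2l (le_trans (H3 _ z3)).
apply: (@le_trans _ _ ((e' * cmod C * (cmod (v z0) + 1) + cmod a * cmod C * e') +
  ((cmod (u z0) + 1) * (e' * cmod C) + e' * (cmod b * cmod C)))).
  apply: le_trans (cmodD _ _) (lerD _ _); apply: le_trans (cmodD _ _) (lerD _ _).
  - by rewrite cmodM ler_pM ?cmod_ge0//; exact: H1.
  - by rewrite !cmodM ler_pM ?mulr_ge0 ?cmod_ge0//; exact: H4.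
  - by rewrite cmodM ler_pM ?cmod_ge0//; exact: H2.
  - by rewrite !cmodM ler_pM ?mulr_ge0 ?cmod_ge0//; exact: H3.
have C0 := cmod_ge0 C.
apply: le_trans (ler_wpM2r C0 e'K).
have -> : e' * K * cmod C = e' * cmod C * K by ring.
rewrite [leLHS](_ : _ = e' * cmod C * (K - 1)); last by rewrite /K; ring.
by apply: ler_wpM2l; [rewrite mulr_ge0// ltW|lra].
Qed.

Lemma strict_derivZ u z0 c a : strict_deriv u z0 a ->
  strict_deriv (fun z => c * u z) z0 (c * a).
Proof.
move=> ua; have := strict_derivM _ _ _ _ _ (strict_deriv_cst c z0) ua.
by rewrite mul0r add0r.
Qed.

Lemma strict_derivX u z0 a n : strict_deriv u z0 a ->
  exists b, strict_deriv (fun z => u z ^+ n) z0 b.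
Proof.
move=> ua; elim: n => [|n [b ub]].
  by exists 0; exact: strict_deriv_cst.
exists (a * u z0 ^+ n + u z0 * b).
rewrite (_ : (fun z => _) = (fun z => u z * u z ^+ n)); last first.
  by apply/funext => z; rewrite exprS.
exact: strict_derivM.
Qed.

Definition holomorphic u := forall z, disc z -> exists a, strict_deriv u z a.

Lemma disc_near z0 : disc z0 -> exists2 d : R, 0 < d &
  forall z, cmod (z - z0) < d -> disc z.
Proof.
rewrite /disc/= => z0d; exists (1 - cmod z0); first by rewrite subr_gt0.
by move=> z; rewrite /disc/= ltrBrDr => /(le_lt_trans _); apply; rewrite -{1}(subrK z0 z) cmodD.
Qed.

(** Strict differentiability at z0 compares all the difference quotients near z0
    with du z0, in particular those that converge to du z. *)
Lemma continuous_deriv u du z0 : (forall z, disc z -> strict_deriv u z (du z)) ->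
  disc z0 -> ccontinuous du z0.
Proof.
move=> udu dz0 e e0; have e2 : 0 < e / 2 by rewrite divr_gt0.
have [d d0 H] := udu _ dz0 _ e2; have [d1 d10 H1] := disc_near _ dz0.
exists (Num.min d d1); first by rewrite lt_min d0.
move=> z; rewrite lt_min => /andP[zd /H1 dz].
have [d2 d20 H2] := udu _ dz _ e2.
pose h := Num.min (d2 / 2) ((d - cmod (z - z0)) / 2).
have h0 : 0 < h by rewrite lt_min divr_gt0//= divr_gt0// subr_gt0.
have hh : cmod h%:C = h by rewrite cmodR gtr0_norm.
have hd2 : h < d2 by rewrite gt_min ltr_pdivrMr// ltr_pMr// ltr1n.
have hd : h < d - cmod (z - z0).
  have g0 : 0 < d - cmod (z - z0) by rewrite subr_gt0.
  by rewrite /h gt_min; apply/orP; right; move: g0; lra.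
have z'1 : cmod (z + h%:C - z0) < d.
  rewrite addrAC; apply: le_lt_trans (cmodD _ _) _.
  by rewrite hh -ltrBrDl.
have A := H _ _ zd z'1.
have := H2 z (z + h%:C); rewrite subrr cmod0 (addrC z) addrK hh.
move=> /(_ d20 hd2) B; move: A; rewrite (addrC z) addrK hh => A.
rewrite -(ler_pM2r h0) -{1}hh -cmodM.
have -> : (du z - du z0) * h%:C = (u (h%:C + z) - u z - du z0 * h%:C)
   - (u (h%:C + z) - u z - du z * h%:C) by ring.
apply: le_trans (cmodB _ _) _; lra.
Qed.

(** F stands for the real part, the imaginary part or the modulus. *)
Lemma continuous_along (T : topologicalType) (x y : T -> R) (t : T)
    (w : R[i] -> R[i]) (F : R[i] -> R) :
  (forall a b, `|F a - F b| <= cmod (a - b)) ->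
  {for t, continuous x} -> {for t, continuous y} ->
  ccontinuous w (x t +i* y t) ->
  {for t, continuous (fun s => F (w (x s +i* y s)))}.
Proof.
move=> F1 cx cy cw; apply/cvgrPdist_le => e e0.
have [d d0 H] := cw _ e0.
have d2 : 0 < d / 2 by rewrite divr_gt0.
near=> s.
rewrite distrC; apply: le_trans (F1 _ _) _; apply: H.
apply: le_lt_trans (cmod_le_ReIm _) _ => /=.
rewrite (splitr d); apply: ltrD.
  by near: s; move/cvgrPdist_lt : cx => /(_ _ d2); under eq_near do rewrite distrC.
by near: s; move/cvgrPdist_lt : cy => /(_ _ d2); under eq_near do rewrite distrC.
Unshelve. all: by end_near. Qed.

Lemma Re_dist (a b : R[i]) : `|complex.Re a - complex.Re b| <= cmod (a - b).
Proof.
rewrite [X in `|X|](_ : _ = complex.Re (a - b)); first exact: Re_le_cmod.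
by case: a; case: b.
Qed.

Lemma Im_dist (a b : R[i]) : `|complex.Im a - complex.Im b| <= cmod (a - b).
Proof.
rewrite [X in `|X|](_ : _ = complex.Im (a - b)); first exact: Im_le_cmod.
by case: a; case: b.
Qed.

(** Chain rule along a path, by Caratheodory's criterion: the slope function q of
    u at the base point is continuous there. *)
Lemma is_derive_along (x y : R -> R) (t x' y' : R) u a :
  is_derive t 1 x x' -> is_derive t 1 y y' ->
  strict_deriv u (x t +i* y t) a ->
  is_derive t 1 (fun s => complex.Re (u (x s +i* y s)))
    (complex.Re (a * (x' +i* y'))).
Proof.
move=> dx dy ua.
have cx : {for t, continuous x}.
  by apply/differentiable_continuous/derivable1_diffP; exact: ex_derive.
have cy : {for t, continuous y}.
  by apply/differentiable_continuous/derivable1_diffP; exact: ex_derive.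
move/is_derive1_caratheodory : dx => [gx [Ex cgx gxt]].
move/is_derive1_caratheodory : dy => [gy [Ey cgy gyt]].
apply/is_derive1_caratheodory.
set z0 := x t +i* y t.
pose q z := if z == z0 then a else (u z - u z0) / (z - z0).
have qE z : u z - u z0 = q z * (z - z0).
  rewrite /q; case: eqP => [->|/eqP zz0]; first by rewrite !subrr mulr0.
  by rewrite divfK// subr_eq0.
have qz0 : q z0 = a by rewrite /q eqxx.
have cq : ccontinuous q (x t +i* y t).
  move=> e e0; have [d d0 H] := ua _ e0; exists d => // z zd.
  rewrite -/z0 qz0 /q; case: eqP => [_|/eqP zz0].
    by rewrite subrr cmod0 ltW.
  have := H z0 z; rewrite subrr cmod0 => /(_ d0 zd).
  have zz00 : 0 < cmod (z - z0) by rewrite cmod_gt0// subr_eq0.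
  move=> K; rewrite -(ler_pM2r zz00) -cmodM mulrBl divfK//.
  by rewrite subr_eq0.
exists (fun s => complex.Re (q (x s +i* y s)) * gx s -
                 complex.Im (q (x s +i* y s)) * gy s).
split.
- move=> s; have -> : complex.Re (u (x s +i* y s)) - complex.Re (u (x t +i* y t)) =
     complex.Re (u (x s +i* y s) - u z0).
    by rewrite /z0; case: (u (x s +i* y s)) => ? ?; case: (u (x t +i* y t)).
  rewrite qE; case: (q _) => A B /=.
  rewrite [x s - x t]Ex [y s - y t]Ey; ring.
- apply: cvgB; apply: cvgM => //.
  + exact: (@continuous_along _ x y t q _ Re_dist cx cy cq).
  + exact: (@continuous_along _ x y t q _ Im_dist cx cy cq).
- by rewrite gxt gyt -/z0 qz0; case: (a).
Qed.

End Calculus.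

(** * Cauchy's estimate *)

Section CauchyEstimate.
Context {R : realType}.
Implicit Types (z w : R[i]) (u v : R[i] -> R[i]).
Notation mu := (@lebesgue_measure R).

Lemma polarE (r t : R) : r%:C * expi t = (r * cos t) +i* (r * sin t).
Proof. by rewrite /expi; simpc. Qed.

(** The Cauchy kernel z / (z - w) = 1 / (1 - w/z) with |w| < |z| takes its values
    in the half-plane Re > 1/2.  This bounds the integral
    of the kernel from below. *)
Lemma Re_cauchy_kernel_ge (x y : R) (a b : R) : a ^+ 2 + b ^+ 2 < x ^+ 2 + y ^+ 2 ->
  2^-1 <= complex.Re ((x +i* y) / (x +i* y - a +i* b)).
Proof.
move=> ab.
have N0 : 0 < (x - a) ^+ 2 + (y - b) ^+ 2.
  rewrite lt_neqAle addr_ge0 ?sqr_ge0// andbT eq_sym.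
  apply: contraTneq ab => /eqP; rewrite paddr_eq0 ?sqr_ge0// !sqrf_eq0 !subr_eq0.
  by move=> /andP[/eqP -> /eqP ->]; rewrite ltxx.
rewrite /= mulrN opprK !mulrA -mulrDl ler_pdivlMr//; nra.
Qed.

Lemma holomorphic_derivative u : holomorphic u ->
  exists du, forall z, disc z -> strict_deriv u z (du z).
Proof.
move=> hu; exists (fun z => xget 0 [set a | strict_deriv u z a]) => z /hu ua.
exact: (@xgetPex _ 0 [set a | strict_deriv u z a]).
Qed.

Lemma integrable_circle (F : R -> R) :
  continuous F -> mu.-integrable `[0, 2 * pi] (EFin \o F).
Proof.
move=> cF; apply: continuous_compact_integrable; first exact: segment_compact.
exact: continuous_subspaceT.
Qed.

(** Cauchy's formula for the point w = a + i b and the circle of radius r, by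
    shrinking the circle z to the point w along w + s (z - w). *)
Section Kernel.
Variables (u du : R[i] -> R[i]) (a b r : R).
Hypothesis udu : forall z, disc z -> strict_deriv u z (du z).
Hypothesis wr : cmod (a +i* b) < r.
Hypothesis r1 : r < 1.

Let X s t := (1 - s) * a + s * (r * cos t).
Let Y s t := (1 - s) * b + s * (r * sin t).
Let z t := (r * cos t) +i* (r * sin t).
Let w := a +i* b.
Let K t := z t / (z t - w).
Let eps := (1 - r) / 4.
Let Phi s t := complex.Re (K t * u (X s t +i* Y s t)).

Let r0 : 0 < r. Proof. exact: le_lt_trans (cmod_ge0 _) wr. Qed.
Let eps0 : 0 < eps. Proof. by rewrite divr_gt0// subr_gt0. Qed.

Let cmodz t : cmod (z t) = r.
Proof. by rewrite /z -polarE cmodM cmod_expi mulr1 cmodR gtr0_norm. Qed.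

Let XYE s t : X s t +i* Y s t = (1 - s)%:C * w + s%:C * z t.
Proof. by rewrite /X /Y /w /z; simpc. Qed.

(** The margin eps lets s range over an open interval around [0, 1], as
    needed to differentiate at both ends. *)
Let XYdisc (s t : R) : - eps <= s <= 1 + eps -> disc (X s t +i* Y s t).
Proof.
move=> /andP[s1 s2]; rewrite /disc /= XYE; apply: le_lt_trans (cmodD _ _) _.
rewrite !cmodM !cmodR cmodz.
apply: (@le_lt_trans _ _ (`|1 - s| * r + `|s| * r)).
  by rewrite lerD2r ler_wpM2l// ltW.
rewrite -mulrDl.
have : `|1 - s| + `|s| <= 1 + 2 * eps.
  have e0 := eps0.
  have [s0|s0] := leP 0 s; have [s3|s3] := leP 0 (1 - s);
  rewrite ?(ger0_norm s0) ?(ger0_norm s3) ?(ltr0_norm s0) ?(ltr0_norm s3); lra.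
move=> /(ler_wpM2r (ltW r0))/le_lt_trans; apply.
have := r0; have := r1; rewrite /eps; nra.
Qed.

Let zw t : z t - w != 0.
Proof.
apply/eqP => /(congr1 (@cmod R)); rewrite cmod0 => zw0.
have := cmodB_ge (z t) w; rewrite zw0 cmodz subr_le0 leNgt.
by rewrite wr.
Qed.

Let cX s t : {for t, continuous (X s)}.
Proof.
apply: cvgD; first exact: cvg_cst.
by apply: cvgM; [exact: cvg_cst|apply: cvgM; [exact: cvg_cst|exact: continuous_cos]].
Qed.

Let cY s t : {for t, continuous (Y s)}.
Proof.
apply: cvgD; first exact: cvg_cst.
by apply: cvgM; [exact: cvg_cst|apply: cvgM; [exact: cvg_cst|exact: continuous_sin]].
Qed.

Let cRcos t : {for t, continuous (fun t => r * cos t)}.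
Proof. by apply: cvgM; [exact: cvg_cst|exact: continuous_cos]. Qed.

Let cRsin t : {for t, continuous (fun t => r * sin t)}.
Proof. by apply: cvgM; [exact: cvg_cst|exact: continuous_sin]. Qed.

Let cinv (c : R[i]) : c != 0 -> ccontinuous GRing.inv c.
Proof.
move=> c0 e e0; have cc := cmod_gt0 _ c0.
exists (Num.min (cmod c / 2) (e * (cmod c ^+ 2 / 2))).
  by rewrite lt_min !(mulr_gt0, divr_gt0)// exprn_gt0.
move=> y; rewrite lt_min => /andP[y1 y2].
have yc : cmod c / 2 < cmod y.
  have := cmodB_ge c y; rewrite cmodBC; lra.
have y0 : y != 0.
  by apply/eqP => y0; move: yc; rewrite y0 cmod0; lra.
have -> : y^-1 - c^-1 = (c - y) / (y * c) by field; rewrite c0 y0.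
rewrite cmodM cmodV cmodM cmodBC ler_pdivrMr ?mulr_gt0//; last exact: cmod_gt0.
apply: le_trans (ltW y2) _; rewrite ler_wpM2l ?(ltW e0)//.
rewrite expr2 mulrAC ler_wpM2r//; exact: ltW.
Qed.

Let cinvzw (F : R[i] -> R) (HF : forall a b, `|F a - F b| <= cmod (a - b)) t :
  {for t, continuous (fun t => F ((z t - w)^-1))}.
Proof.
have := @continuous_along R R (fun t => r * cos t - a) (fun t => r * sin t - b) t
  GRing.inv F HF.
apply.
- by apply: cvgB; [exact: cRcos|exact: cvg_cst].
- by apply: cvgB; [exact: cRsin|exact: cvg_cst].
- exact: cinv (zw t).
Qed.

Let Re_mul (p q : R[i]) : complex.Re (p * q) =
  complex.Re p * complex.Re q - complex.Im p * complex.Im q.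
Proof. by case: p; case: q. Qed.

Let Im_mul (p q : R[i]) : complex.Im (p * q) =
  complex.Re p * complex.Im q + complex.Im p * complex.Re q.
Proof. by case: p; case: q. Qed.

Let cPhi (s t : R) : - eps <= s <= 1 + eps -> {for t, continuous (Phi s)}.
Proof.
move=> sI.
have cu := strict_deriv_continuous _ _ _ (udu _ (XYdisc s t sI)).
have c1 := cinvzw _ Re_dist t; have c2 := cinvzw _ Im_dist t.
have c3 := @continuous_along _ _ _ _ _ _ _ Re_dist (cX s t) (cY s t) cu.
have c4 := @continuous_along _ _ _ _ _ _ _ Im_dist (cX s t) (cY s t) cu.
have -> : Phi s = (fun t => (r * cos t * complex.Re ((z t - w)^-1) -
    r * sin t * complex.Im ((z t - w)^-1)) * complex.Re (u (X s t +i* Y s t)) -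
   (r * cos t * complex.Im ((z t - w)^-1) +
    r * sin t * complex.Re ((z t - w)^-1)) * complex.Im (u (X s t +i* Y s t))).
  by apply/funext => t'; rewrite /Phi /K !Re_mul !Im_mul.
apply: cvgB; apply: cvgM => //.
  by apply: cvgB; apply: cvgM => //; [exact: cRcos|exact: cRsin].
by apply: cvgD; apply: cvgM => //; [exact: cRcos|exact: cRsin].
Qed.

Let dPhi (s t : R) : - eps <= s <= 1 + eps ->
  is_derive s 1 (Phi ^~ t) (complex.Re (du (X s t +i* Y s t) * z t)).
Proof.
move=> sI.
have := @is_derive_along _ (X ^~ t) (Y ^~ t) s (r * cos t - a) (r * sin t - b)
  (fun p => K t * u p) (K t * du (X s t +i* Y s t)).
have -> : K t * du (X s t +i* Y s t) * ((r * cos t - a) +i* (r * sin t - b)) =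
   du (X s t +i* Y s t) * z t.
  rewrite -[_ +i* (_ - b)]/(z t - w) mulrAC /K divfK ?zw//; exact: mulrC.
apply.
- rewrite /X; apply: is_derive_eq; rewrite /GRing.scale/=; ring.
- rewrite /Y; apply: is_derive_eq; rewrite /GRing.scale/=; ring.
- exact/strict_derivZ/udu/XYdisc.
Qed.


(** The s-derivative of [Phi]: the factor z - w of the velocity cancels
    the denominator of the kernel. *)
Let G s t := complex.Re (du (X s t +i* Y s t) * z t).

Let cdu (s t : R) : - eps <= s <= 1 + eps -> ccontinuous du (X s t +i* Y s t).
Proof. by move=> sI; apply: continuous_deriv udu _; exact: XYdisc. Qed.

Let cG (s t : R) : - eps <= s <= 1 + eps -> {for t, continuous (G s)}.
Proof.
move=> sI; have cd := cdu s t sI.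
have c3 := @continuous_along _ _ _ _ _ _ _ Re_dist (cX s t) (cY s t) cd.
have c4 := @continuous_along _ _ _ _ _ _ _ Im_dist (cX s t) (cY s t) cd.
have -> : G s = (fun t => complex.Re (du (X s t +i* Y s t)) * (r * cos t) -
   complex.Im (du (X s t +i* Y s t)) * (r * sin t)).
  by apply/funext => t'; rewrite /G Re_mul.
by apply: cvgB; apply: cvgM => //; [exact: cRcos|exact: cRsin].
Qed.

(** Domination for the derivative under the integral sign. *)
Let G_bounded : exists2 M : R, 0 <= M &
  forall s t, - eps <= s <= 1 + eps -> 0 <= t <= 2 * pi -> `|G s t| <= M.
Proof.
have cpt : compact (`[- eps, 1 + eps] `*` `[0, 2 * pi] : set (R * R)).
  by apply: compact_setX; exact: segment_compact.
pose D (p : R * R) := cmod (du (X p.1 p.2 +i* Y p.1 p.2)).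
have e0 := eps0.
have ne : (`[- eps, 1 + eps] `*` `[0, 2 * pi] : set (R * R)) !=set0.
  exists (0, 0); split => /=; rewrite in_itv/= ?lexx ?mulr_ge0 ?pi_ge0//; lra.
have cD : {within (`[- eps, 1 + eps] `*` `[0, 2 * pi] : set (R * R)), continuous D}.
  apply: continuous_in_subspaceT => -[s t] /set_mem[/= sI tI].
  rewrite /D; apply: (@continuous_along R (R * R)%type (fun p => X p.1 p.2)
    (fun p => Y p.1 p.2) (s, t) du (@cmod R) (@cmod_distr R)).
  - apply: cvgD; apply: cvgM.
    + by apply: cvgB; [exact: cvg_cst|exact: cvg_fst].
    + exact: cvg_cst.
    + exact: cvg_fst.
    + apply: cvgM; first exact: cvg_cst.
      by apply: continuous_comp; [exact: cvg_snd|exact: continuous_cos].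
  - apply: cvgD; apply: cvgM.
    + by apply: cvgB; [exact: cvg_cst|exact: cvg_fst].
    + exact: cvg_cst.
    + exact: cvg_fst.
    + apply: cvgM; first exact: cvg_cst.
      by apply: continuous_comp; [exact: cvg_snd|exact: continuous_sin].
  - by apply: cdu; rewrite in_itv/= in sI.
have [c _ Hc] := compact_EVT_max ne cpt cD.
exists (D c); first exact: cmod_ge0.
move=> s t sI tI; rewrite /G.
apply: le_trans (Re_le_cmod _) _; rewrite cmodM cmodz.
apply: (@le_trans _ _ (D (s, t))).
  by rewrite ler_piMr ?cmod_ge0// ltW.
by apply: Hc; rewrite inE; split; rewrite /= in_itv.
Qed.

Let B : set R := `[0, 2 * pi].

Let mB : measurable (B : set (measurableTypeR R)). Proof. exact: measurable_itv. Qed.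

(** G s is the t-derivative of the real part of (- i / s) u (w + s (z - w)),
    a 2 pi-periodic function of t. *)
Let integral_G (s : R) : s != 0 -> - eps <= s <= 1 + eps -> \int[mu]_(t in B) G s t = 0.
Proof.
move=> s0 sI.
pose P t := complex.Re ((0 -i* s^-1) * u (X s t +i* Y s t)).
have dP (t : R) : is_derive t 1 P (G s t).
  have := @is_derive_along _ (X s) (Y s) t (s * (r * - sin t)) (s * (r * cos t))
    (fun p => (0 -i* s^-1) * u p) ((0 -i* s^-1) * du (X s t +i* Y s t)).
  have -> : complex.Re ((0 -i* s^-1) * du (X s t +i* Y s t) *
      ((s * (r * - sin t)) +i* (s * (r * cos t)))) = G s t.
    rewrite /G; case: (du _) => p q /=; field; exact: s0.
  apply.
  - rewrite /X; apply: is_derive_eq; rewrite /GRing.scale/=; ring.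
  - rewrite /Y; apply: is_derive_eq; rewrite /GRing.scale/=; ring.
  - exact/strict_derivZ/udu/XYdisc.
have cP (t : R) : {for t, continuous P}.
  by apply/differentiable_continuous/derivable1_diffP; exact: ex_derive.
rewrite /Rintegral (@continuous_FTC2 _ _ P).
- rewrite -EFinB /=.
  have pi2 : 2 * pi = pi *+ 2 :> R by rewrite mulr_natl.
  by rewrite /P /X /Y pi2 cos2pi sin2pi cos0 sin0 subrr.
- by rewrite mulr_gt0// pi_gt0.
- by apply: continuous_subspaceT => t; exact: cG.
- split.
  + by move=> t _; exact: ex_derive.
  + exact/cvg_at_right_filter/cP.
  + exact/cvg_at_left_filter/cP.
- by move=> t _; rewrite derive1E; exact: derive_val.
Qed.

Let F s := \int[mu]_(t in B) Phi s t.

Let F_derivable (s : R) : - eps < s < 1 + eps ->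
  is_derive s 1 F (\int[mu]_(t in B) G s t).
Proof.
move=> sI.
have ooW (x : R) : - eps < x < 1 + eps -> - eps <= x <= 1 + eps.
  by move=> /andP[/ltW -> /ltW ->].
have [M M0 HM] := G_bounded.
have sI' : `]- eps, 1 + eps[%classic s by rewrite /= in_itv/=.
have intf (x : R) : `]- eps, 1 + eps[%classic x -> mu.-integrable B (EFin \o Phi x).
  by rewrite /= in_itv/= => /ooW xI; apply: integrable_circle => t; exact: cPhi.
have der (x t : R) : `]- eps, 1 + eps[%classic x -> B t -> derivable (Phi ^~ t) x 1.
  by rewrite /= in_itv/= => /ooW xI _; have := dPhi x t xI => ?; exact: ex_derive.
have d1E (x t : R) : - eps < x < 1 + eps -> partial1of2 Phi x t = G x t.
  by move=> /ooW xI; rewrite partial1of2E; have := dPhi x t xI => ?; exact: derive_val.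
have intM : mu.-integrable B (EFin \o (fun=> M)).
  by apply: integrable_circle => t; exact: cvg_cst.
have bnd (x t : R) : `]- eps, 1 + eps[%classic x -> B t -> `|partial1of2 Phi x t| <= M.
  rewrite /B /= !in_itv/= => xI tI; rewrite d1E//; apply: HM => //; exact: ooW.
have M0' (t : R) : 0 <= M by [].
apply: DeriveDef.
  exact: (derivable_under_integral mB sI' intf der M0' intM bnd).
rewrite -derive1E (differentiation_under_integral mB sI' intf der M0' intM bnd).
by apply: eq_Rintegral => t _; exact: d1E.
Qed.

Let F_cst : F 0 = F 1.
Proof.
have e0 := eps0.
have FI (s : R) : 0 <= s <= 1 -> - eps < s < 1 + eps by move=> /andP[? ?]; lra.
have [||c cI] := @MVT _ F (fun s => \int[mu]_(t in B) G s t) 0 1 ltr01.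
- by move=> s; rewrite in_itv/= => /andP[/ltW s0 /ltW s1]; apply/F_derivable/FI; rewrite s0.
- apply: continuous_in_subspaceT => s /set_mem /=; rewrite in_itv/= => /FI/F_derivable Fs.
  by apply/differentiable_continuous/derivable1_diffP; exact: ex_derive.
rewrite integral_G; last 2 first.
- by move: cI; rewrite in_itv/= => /andP[c0 _]; rewrite gt_eqF.
- by move: cI; rewrite in_itv/= => /andP[c0 c1]; lra.
by rewrite mul0r => /eqP; rewrite subr_eq0 => /eqP.
Qed.

(** The integral of [Phi] s does not depend on s; its values at s = 0 and s = 1 are
    the two sides. *)
Lemma kernel_identity : \int[mu]_(t in `[0, 2 * pi]) complex.Re (K t * u w) =
  \int[mu]_(t in `[0, 2 * pi]) complex.Re (K t * u (z t)).
Proof.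
move: F_cst; rewrite /F /B /Phi => F01.
transitivity (\int[mu]_(x in B) complex.Re (K x * u (X 0 x +i* Y 0 x))).
  by apply: eq_Rintegral => t _; rewrite XYE subr0 rmorph1 rmorph0 mul1r mul0r addr0.
rewrite F01; apply: eq_Rintegral => t _.
by rewrite XYE subrr rmorph1 rmorph0 mul1r mul0r add0r.
Qed.

Lemma kernel_continuous_center : continuous (fun t => complex.Re (K t * u w)).
Proof.
move=> t; have -> : (fun t => complex.Re (K t * u w)) = Phi 0.
  by apply/funext => t'; rewrite /Phi XYE subr0 rmorph1 rmorph0 mul1r mul0r addr0.
by apply: cPhi; have e0 := eps0; lra.
Qed.

Lemma kernel_continuous : continuous (fun t => complex.Re (K t * u (z t))).
Proof.
move=> t; have -> : (fun t => complex.Re (K t * u (z t))) = Phi 1.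
  by apply/funext => t'; rewrite /Phi XYE subrr rmorph1 rmorph0 mul1r mul0r add0r.
by apply: cPhi; have e0 := eps0; lra.
Qed.

End Kernel.

Lemma polar_disc (r t : R) : 0 <= r < 1 -> disc (r%:C * expi t).
Proof.
by move=> /andP[r0 r1]; rewrite /disc/= cmodM cmod_expi mulr1 cmodR ger0_norm.
Qed.

Lemma continuous_circle u (G : R[i] -> R) (r : R) : holomorphic u -> 0 <= r < 1 ->
  (forall a b, `|G a - G b| <= cmod (a - b)) ->
  continuous (fun t => G (u (r%:C * expi t))).
Proof.
move=> hu r01 G1 t; have [a ua] := hu _ (polar_disc _ t r01).
under eq_fun do rewrite polarE.
apply: (@continuous_along R R (fun t => r * cos t) (fun t => r * sin t) t u G G1).
- by apply: cvgM; [exact: cvg_cst|exact: continuous_cos].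
- by apply: cvgM; [exact: cvg_cst|exact: continuous_sin].
- by rewrite -polarE; exact: strict_deriv_continuous ua.
Qed.


Definition circle_L1 u (r : R) : R :=
  \int[mu]_(t in `[0, 2 * pi]) cmod (u (r%:C * expi t)).

Lemma circle_measure : fine (mu (`[0%R, 2 * pi]%classic : set R)) = 2 * pi.
Proof.
by rewrite lebesgue_measure_itv/= lte_fin mulr_gt0 ?pi_gt0//= subr0.
Qed.

(** Multiplying u by the conjugate of u w makes the value at w real and
    nonnegative; then the real part of the Cauchy integral is at least
    pi |u w|^2, as the kernel has real part at least 1/2, and at most
    |u w| r / (r - |w|) times the L^1 norm on the circle. *)
Lemma cauchy_estimate u w r : holomorphic u -> cmod w < r -> r < 1 ->
  pi * cmod (u w) * (r - cmod w) <= r * circle_L1 u r.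
Proof.
move=> hu wr r1.
have r0 : 0 < r by exact: le_lt_trans (cmod_ge0 _) wr.
have J0 : 0 <= circle_L1 u r by apply: Rintegral_ge0 => t _; exact: cmod_ge0.
have [uw0|uw0] := eqVneq (u w) 0.
  by rewrite uw0 cmod0 mulr0 mul0r mulr_ge0// ltW.
have cuw := cmod_gt0 _ uw0.
pose v y := conjc (u w) * u y.
have hv : holomorphic v.
  by move=> y /hu[a ua]; exists (conjc (u w) * a); exact: strict_derivZ.
have vw : v w = (cmod (u w) ^+ 2)%:C.
  rewrite /v; case: (u w) => p q; rewrite cmod_sqrt sqr_sqrtr ?addr_ge0 ?sqr_ge0//.
  by simpc; rewrite -!expr2 [q * p]mulrC subrr.
have [dv Hdv] := holomorphic_derivative _ hv.
case: w wr uw0 cuw @v hv vw Hdv => a b wr uw0 cuw v hv vw Hdv.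
have := @kernel_identity v dv a b r Hdv wr r1.
set w := a +i* b.
pose z t := (r * cos t) +i* (r * sin t).
pose K t := z t / (z t - w).
have zcmod t : cmod (z t) = r.
  by rewrite /z -polarE cmodM cmod_expi mulr1 cmodR gtr0_norm.
have zw t : r - cmod w <= cmod (z t - w).
  by have := cmodB_ge (z t) w; rewrite zcmod.
have rw0 : 0 < r - cmod w by rewrite subr_gt0.
have KE t : cmod (K t) <= r / (r - cmod w).
  rewrite /K cmodM cmodV zcmod ler_wpM2l ?(ltW r0)//.
  by rewrite lef_pV2 ?posrE//; exact: lt_le_trans (zw t).
move=> kid.
have cu : continuous (fun t => cmod (u (r%:C * expi t))).
  by apply: (@continuous_circle u (@cmod R) r hu _ (@cmod_distr R)); rewrite (ltW r0).
have mB : measurable (`[0%R, 2 * pi]%classic : set (measurableTypeR R)).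
  exact: measurable_itv.
have int1 := integrable_circle _ cu.
have upper : \int[mu]_(t in `[0, 2 * pi]) complex.Re (K t * v (z t)) <=
    r / (r - cmod w) * cmod (u w) * circle_L1 u r.
  rewrite /circle_L1 -RintegralZl//.
  apply: le_Rintegral => //.
  - exact/integrable_circle/(@kernel_continuous v dv a b r Hdv wr r1).
  - by apply/integrable_circle => t; apply: cvgM; [exact: cvg_cst|exact: cu].
  - move=> t _; apply: le_trans (ler_norm _) _; apply: le_trans (Re_le_cmod _) _.
    rewrite polarE -/(z t) /v cmodM (cmodM (conjc _)) mulrA.
    rewrite ler_wpM2r ?cmod_ge0// ler_pM ?cmod_ge0// ?KE//.
    by case: (u w) => p q; rewrite !cmod_sqrt sqrrN.
have lower : pi * cmod (u w) ^+ 2 <= \int[mu]_(t in `[0, 2 * pi]) complex.Re (K t * v w).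
  have -> : pi * cmod (u w) ^+ 2 =
      \int[mu]_(t in `[0, 2 * pi]) (2^-1 * cmod (u w) ^+ 2).
    by rewrite Rintegral_cst// circle_measure; field.
  apply: le_Rintegral => //.
  - by apply: integrable_circle => t; exact: cvg_cst.
  - exact/integrable_circle/(@kernel_continuous_center v dv a b r Hdv wr r1).
  - move=> t _; rewrite vw.
    have -> : complex.Re (K t * (cmod (u w) ^+ 2)%:C) =
       complex.Re (K t) * cmod (u w) ^+ 2.
      by case: (K t) => p q /=; rewrite mulr0 subr0.
    apply: ler_wpM2r; first exact: sqr_ge0.
    apply: Re_cauchy_kernel_ge.
    rewrite -(@ltr_sqrt R); last first.
      rewrite -[X in 0 < X]sqr_sqrtr ?addr_ge0 ?sqr_ge0// -cmod_sqrt.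
      by rewrite -/(z t) zcmod exprn_gt0.
    by rewrite -!cmod_sqrt -/(z t) zcmod.
have : pi * cmod (u w) ^+ 2 <= r / (r - cmod w) * cmod (u w) * circle_L1 u r.
  by apply: le_trans lower _; rewrite kid.
have -> : pi * cmod (u w) ^+ 2 = pi * cmod (u w) * cmod (u w) by ring.
rewrite [r / _ * _ * _]mulrAC ler_pM2r//.
rewrite [r / _ * _]mulrAC ler_pdivlMr//.
Qed.

End CauchyEstimate.

(** * Inner functions *)

Section InnerFunctions.
Context {R : realType}.
Implicit Types (z w : R[i]) (u v f : R[i] -> R[i]).
Notation mu := (@lebesgue_measure R).

Lemma analytic_holomorphic f : analytic_on (@disc R) f -> holomorphic f.
Proof. exact: analytic_strict_deriv. Qed.

Lemma boundary_value_cmod f (zeta w : R[i]) : boundary_value f zeta w ->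
  cmod (f (r%:C * zeta)) @[r --> (1 : R)^'-] --> cmod w.
Proof.
move=> fw; apply/cvgrPdist_le => e e0.
have e0' : 0 < e%:C by rewrite ltcR.
move: fw => /(@cvgrPdist_le _ R[i]^o _ _ _ _ _)/(_ _ e0'); apply: filterS => r /=.
rewrite normc_cmod lecR => H; apply: le_trans (cmod_distr _ _) H.
Qed.

(** Dominated convergence: f is bounded, and |f| tends to 1 along almost every
    radius. *)
Lemma inner_pow_mean_cvg f n : inner_function f ->
  circle_L1 (fun z => f z ^+ n) (1 - k.+1%:R^-1) @[k --> \oo] --> 2 * pi.
Proof.
move=> [fa [M fM] fb].
have hf := analytic_holomorphic _ fa.
pose rk k : R := 1 - k.+1%:R^-1.
have rk01 k : 0 <= rk k < 1.
  rewrite subr_ge0 gtrBl invr_gt0 ltr0n andbT.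
  by rewrite invf_le1 ?ltr0n// ler1n.
have rk1 : rk k @[k --> \oo] --> (1 : R).
  rewrite -[X in _ --> X]subr0; apply: cvgB; first exact: cvg_cst.
  exact: cvg_harmonic.
have mB : measurable (`[0%R, 2 * pi]%classic : set (measurableTypeR R)).
  exact: measurable_itv.
have hfn : holomorphic (fun z => f z ^+ n).
  by move=> z /hf[a fza]; exact: strict_derivX fza.
have cfn k : continuous (fun t => cmod (f ((rk k)%:C * expi t) ^+ n)).
  exact: (@continuous_circle R (fun z => f z ^+ n) (@cmod R) _ hfn (rk01 k) (@cmod_distr R)).
have M0 : 0 <= M.
  apply: le_trans (cmod_ge0 (f 0)) (fM _ _).
  by rewrite /disc/= cmod0.
have [] := @dominated_convergence _ _ _ mu _ mB
  (fun k t => (cmod (f ((rk k)%:C * expi t) ^+ n))%:E) (cst 1%E) (cst (M ^+ n)%:E).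
- move=> k. apply/measurable_EFinP. apply: measurable_funTS. apply: continuous_measurable_fun. exact: (cfn k).
- exact: measurable_cst.
- have n2pi : {ae mu, forall t : R, t != 2 * pi}.
    exists [set 2 * pi]; split => //; first exact: lebesgue_measure_set1.
    by move=> t /= /negP; rewrite negbK => /eqP.
  apply: (@filterS2 _ _ (ae_filter_ringOfSetsType mu) _ _ _ _ fb n2pi) => t Ht t2 tI.
  have [|w [fw w1]] := Ht.
    by move: tI; rewrite /= in_itv/= => /andP[-> t3]; rewrite lt_neqAle t2.
  apply: cvg_EFin; first exact: nearW.
  rewrite -[X in _ --> X](expr1n _ n) -w1.
  under eq_fun do rewrite /= cmodX.
  apply: (@cvg_comp _ _ _ (fun k => cmod (f ((rk k)%:C * expi t))) (fun x => x ^+ n) _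
      (nbhs (cmod w)) _ _); last exact: exprn_continuous.
  move/boundary_value_cmod/cvg_at_leftP : fw; apply; split => //.
  by move=> k; have /andP[] := rk01 k.
- by apply: integrable_circle => t; exact: cvg_cst.
- apply: aeW => t /= k _; rewrite lee_fin ger0_norm ?cmod_ge0// cmodX.
  by rewrite lerXn2r ?nnegrE ?cmod_ge0//; exact/fM/polar_disc.
have E : (\int[mu]_(x in `[0%R, (2 * pi)%R]) cst 1 x)%E = (2 * pi)%:E.
  rewrite integral_cst//= lebesgue_measure_itv/= lte_fin mulr_gt0 ?pi_gt0//=.
  by rewrite sube0 mul1e.
by move=> _ _; rewrite E => /fine_cvgP[].
Qed.

Lemma inner_pow_mean_approx f n (rho e : R) : inner_function f -> rho < 1 -> 0 < e ->
  exists2 r, [&& 0 <= r, rho < r & r < 1] &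
    `|2 * pi - circle_L1 (fun z => f z ^+ n) r| < e.
Proof.
move=> fi rho1 e0.
have rk1 : 1 - k.+1%:R^-1 @[k --> \oo] --> (1 : R).
  rewrite -[X in _ --> X]subr0; apply: cvgB; first exact: cvg_cst.
  exact: cvg_harmonic.
have A : \forall k \near \oo, `|2 * pi - circle_L1 (fun z => f z ^+ n) (1 - k.+1%:R^-1)| < e.
  by have /cvgrPdist_lt/(_ _ e0) := inner_pow_mean_cvg _ n fi.
have B : \forall k \near \oo, rho < 1 - k.+1%:R^-1 :> R.
  exact: cvgr_gt rk1 _ rho1.
have [k [ke krho]] := @filter_ex _ _ _ _ (filterI A B).
exists (1 - k.+1%:R^-1) => //.
rewrite krho/= subr_ge0 gtrBl invr_gt0 ltr0n andbT.
by rewrite invf_le1 ?ltr0n// ler1n.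
Qed.

(** Cauchy's estimate for f^n gives |f z|^n <= C with C independent of n, as the
    integrals of |f|^n over circles tend to 2 pi. *)
Lemma inner_le1 f z : inner_function f -> disc z -> cmod (f z) <= 1.
Proof.
move=> fi dz; rewrite leNgt; apply/negP => fz1.
have hf : holomorphic f by case: fi => fa _ _; exact: analytic_holomorphic.
have z1 : cmod z < 1 by [].
pose rho := (1 + cmod z) / 2.
have rho1 : rho < 1 by rewrite /rho; lra.
pose C := 3 / (rho - cmod z).
have rz : 0 < rho - cmod z by rewrite /rho; lra.
have bnd n : cmod (f z) ^+ n <= C.
  have [r /and3P[r0 rr r1] Hr] := inner_pow_mean_approx f n _ _ fi rho1 (@pi_gt0 R).
  have hfn : holomorphic (fun z => f z ^+ n).
    by move=> y /hf[a fza]; exact: strict_derivX fza.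
  have zr : cmod z < r by apply: lt_trans rr; rewrite -subr_gt0.
  have := cauchy_estimate _ _ _ hfn zr r1.
  move: Hr; rewrite ltr_distlC => /andP[_]; rewrite cmodX.
  set J := circle_L1 _ _ => HJ H; have p0 := @pi_gt0 R.
  rewrite ler_pdivlMr// -(ler_pM2l p0).
  have fn0 : 0 <= cmod (f z) ^+ n by rewrite exprn_ge0 ?cmod_ge0.
  apply: (@le_trans _ _ (r * J)); last nra.
  apply: le_trans H; rewrite mulrA; apply: ler_wpM2l.
    by rewrite mulr_ge0// ltW.
  by rewrite lerD2r ltW.
have C0 : 0 < C by rewrite divr_gt0.
have q1 : `|(cmod (f z))^-1| < 1.
  by rewrite ger0_norm ?invr_ge0 ?cmod_ge0// invf_lt1// (lt_trans ltr01).
have /cvgrPdist_lt/(_ C^-1) := cvg_expr q1.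
rewrite invr_gt0 => /(_ C0)/filter_ex[n].
rewrite sub0r normrN ger0_norm ?exprn_ge0 ?invr_ge0 ?cmod_ge0//.
have f0 : 0 < cmod (f z) by exact: lt_trans fz1.
rewrite exprVn ltf_pV2 ?posrE ?exprn_gt0//.
by rewrite ltNge bnd.
Qed.

End InnerFunctions.

(** * The derivative of a concave function *)

Lemma nonincreasing_on_measurable (R : realType) (I : interval R) (f : R -> R) :
  {in [set` I] &, nonincreasing_fun f} ->
  measurable_fun ([set` I] : set (measurableTypeR R)) f.
Proof.
move=> fI; apply: (measurability (@RGenCInfty.G R)).
  exact: RGenCInfty.measurableE.
move=> _ [_ [r] -> <-]; apply: is_interval_measurable => s t /= [Is rs] [It rt] u sut.
have Iu : [set` I] u by exact: (interval_is_interval Is It sut).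
split => //; move: rt; rewrite /= !in_itv/= !andbT => /le_trans; apply.
by apply: fI; rewrite ?inE//; case/andP : sut.
Qed.

(** The left derivative of phi replaces phi' everywhere: unlike phi', it is defined
    at each point of the open interval, and it is strictly decreasing there. *)
Section ConcaveWeight.
Context {R : realType}.
Variables (phi : R -> R) (L : R).
Hypothesis L0 : 0 < L.
Hypothesis phi_incr : forall x y : R, 0 <= x -> x < y -> y <= L -> phi x < phi y.
Hypothesis phi_conc : strictly_concave_on `[0, L] phi.
Notation mu := (@lebesgue_measure R).

Let slope (s t : R) := (phi t - phi s) / (t - s).

Let three_chords x y z : 0 <= x -> x < y -> y < z -> z <= L ->
  (y - x) * (phi z - phi y) < (z - y) * (phi y - phi x).
Proof.
move=> x0 xy yz zL.
have zx : 0 < z - x by rewrite subr_gt0 (lt_trans xy).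
have := @phi_conc x z ((z - y) / (z - x)).
rewrite /= !in_itv/= x0 zL (le_trans (ltW (lt_trans xy yz)) zL).
rewrite (le_trans x0 (ltW (lt_trans xy yz))) => /(_ isT isT).
rewrite lt_eqF ?(lt_trans xy)// => /(_ isT).
have -> : 0 < (z - y) / (z - x) < 1.
  apply/andP; split; first by rewrite divr_gt0// subr_gt0.
  by rewrite ltr_pdivrMr// mul1r; lra.
move=> /(_ isT).
have -> : (z - y) / (z - x) * x + (1 - (z - y) / (z - x)) * z = y.
  by field; rewrite gt_eqF.
rewrite -(ltr_pM2l zx).
have -> : (z - x) * ((z - y) / (z - x) * phi x + (1 - (z - y) / (z - x)) * phi z) =
  (z - y) * phi x + (y - x) * phi z by field; rewrite gt_eqF.
lra.
Qed.

Let slope_lt x y z : 0 <= x -> x < y -> y < z -> z <= L -> slope y z < slope x y.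
Proof.
move=> x0 xy yz zL; rewrite /slope ltr_pdivrMr ?subr_gt0// mulrAC ltr_pdivlMr ?subr_gt0//.
by have := @three_chords x y z x0 xy yz zL; lra.
Qed.

Let slope_ltl x y z : 0 <= x -> x < y -> y < z -> z <= L -> slope x z < slope x y.
Proof.
move=> x0 xy yz zL; rewrite /slope ltr_pdivrMr ?subr_gt0 ?(lt_trans xy)//.
rewrite mulrAC ltr_pdivlMr ?subr_gt0//.
by have := @three_chords x y z x0 xy yz zL; nra.
Qed.

Let slope_ltr x y z : 0 <= x -> x < y -> y < z -> z <= L -> slope y z < slope x z.
Proof.
move=> x0 xy yz zL; rewrite /slope ltr_pdivrMr ?subr_gt0//.
rewrite mulrAC ltr_pdivlMr ?subr_gt0 ?(lt_trans xy)//.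
by have := @three_chords x y z x0 xy yz zL; nra.
Qed.

Definition left_slope (t : R) := inf [set slope s t | s in `[0, t[ ].

Let has_inf_slope t : 0 < t -> t < L -> has_inf [set slope s t | s in `[0, t[ ].
Proof.
move=> t0 tL; split; first by exists (slope 0 t), 0 => //=; rewrite in_itv/= lexx.
exists (slope t L) => _ [s /= + <-]; rewrite in_itv/= => /andP[s0 st].
exact/ltW/slope_lt.
Qed.

Lemma left_slope_le s t : 0 <= s -> s < t -> t < L -> left_slope t <= slope s t.
Proof.
move=> s0 st tL; have t0 : 0 < t by exact: le_lt_trans st.
apply: ge_inf; first by have [] := has_inf_slope _ t0 tL.
by exists s => //=; rewrite in_itv/= s0.
Qed.

Lemma slope_le_left t y : 0 < t -> t < y -> y <= L -> slope t y <= left_slope t.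
Proof.
move=> t0 ty yL; apply: lb_le_inf.
  by have [] := has_inf_slope _ t0 (lt_le_trans ty yL).
move=> _ [s /= + <-]; rewrite in_itv/= => /andP[s0 st].
exact/ltW/slope_lt.
Qed.

Lemma left_slope_decr t y : 0 < t -> t < y -> y < L -> left_slope y < left_slope t.
Proof.
move=> t0 ty yL; pose m := (t + y) / 2.
have tm : t < m by rewrite /m; lra.
have my : m < y by rewrite /m; lra.
apply: le_lt_trans (left_slope_le m y _ my yL) _; first by rewrite ltW// (lt_trans t0).
apply: lt_le_trans (slope_lt t m y (ltW t0) tm my (ltW yL)) _.
by apply: slope_le_left => //; rewrite ltW// (lt_trans my).
Qed.

Lemma left_slope_gt0 t : 0 < t -> t < L -> 0 < left_slope t.
Proof.
move=> t0 tL; apply: lt_le_trans (slope_le_left t L t0 tL (lexx _)).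
by rewrite divr_gt0 ?subr_gt0// phi_incr// ltW.
Qed.

(** By concavity the right derivative is at most the left one; the hypothesis
    says that they agree. *)
Let derive_left_slope t : 0 < t -> t < L ->
  (forall q, q < left_slope t -> exists2 y, t < y <= L & q < slope t y) ->
  derive1 (phi : R -> R^o) t = left_slope t.
Proof.
move=> t0 tL Ht; rewrite /derive1; apply: cvg_lim => //.
apply/cvgrPdist_le => e e0.
have [y /andP[ty yL] ye] := Ht (left_slope t - e) (ltac:(lra)).
have [s0 /= [s + <-] se] := @inf_adherent _ _ _ e0 (has_inf_slope t t0 tL).
rewrite /= in_itv/= => /andP[s00 st].
have d0 : 0 < Num.min (y - t) (t - s) by rewrite lt_min !subr_gt0 ty.
near=> h.
have h0 : h != 0 by near: h; exact: nbhs_dnbhs_neq.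
have : `|h| < Num.min (y - t) (t - s).
  by near: h; apply: dnbhs0_lt.
rewrite lt_min => /andP[hy hs].
rewrite /= [_ *: _]mulrC.
have [hpos|hneg] := ltP 0 h.
  rewrite gtr0_norm// in hy.
  have A : slope t (t + h) <= left_slope t by apply: slope_le_left; lra.
  have B : slope t y <= slope t (t + h) by apply/ltW/slope_ltl; lra.
  have -> : (phi (h + t) - phi t) / h = slope t (t + h).
    by rewrite /slope (addrC h) (_ : t + h - t = h)//; lra.
  rewrite ler_norml; lra.
have {}hneg : h < 0 by rewrite lt_neqAle h0.
rewrite ltr0_norm// in hs.
have A : left_slope t <= slope (t + h) t by apply: left_slope_le; lra.
have B : slope (t + h) t <= slope s t by apply/ltW/slope_ltr; lra.
have -> : (phi (h + t) - phi t) / h = slope (t + h) t.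
  by rewrite /slope (addrC h) (_ : t - (t + h) = - h) ?invrN ?mulrN -?mulNr ?opprB//; lra.
move: se; rewrite -/(left_slope t) ler_norml; lra.
Unshelve. all: by end_near. Qed.

(** At an exceptional point there is a rational between the right and left
    derivatives.  The open intervals so bounded are disjoint, so this choice
    of rationals is injective. *)
Lemma derive_concave : exists2 E : set R, countable E &
  forall t, 0 < t < L -> ~ E t -> derive1 (phi : R -> R^o) t = left_slope t.
Proof.
pose E := [set t : R | 0 < t < L /\ exists q : rat, ratr q < left_slope t /\
   forall y, t < y <= L -> slope t y <= ratr q].
have cE : countable E.
  pose q t := xget 0%Q [set q : rat | ratr q < left_slope t /\
     forall y, t < y <= L -> slope t y <= ratr q].
  have qP t : E t -> ratr (q t) < left_slope t /\
     forall y, t < y <= L -> slope t y <= ratr (q t).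
    move=> [_ [q0 q0P]]; exact: (@xgetPex _ 0%Q [set q : rat | ratr q < left_slope t /\
     forall y, t < y <= L -> slope t y <= ratr q]) (ex_intro _ q0 q0P).
  have qlt t t' : E t -> E t' -> t < t' -> ratr (q t') < ratr (q t) :> R.
    move=> Et Et' tt'; have [qt1 qt2] := qP _ Et; have [qt'1 qt'2] := qP _ Et'.
    have [/andP[t0 tL] _] := Et; have [/andP[t'0 t'L] _] := Et'.
    apply: lt_le_trans qt'1 _; apply: le_trans (qt2 t' _); last by rewrite tt' ltW.
    by apply: left_slope_le => //; exact: ltW.
  have qinj : {in E &, injective q}.
    move=> t t' /set_mem Et /set_mem Et' qq.
    have [tt'|tt'|//] := ltgtP t t'.
      by have := qlt _ _ Et Et' tt'; rewrite qq ltxx.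
    by have := qlt _ _ Et' Et tt'; rewrite qq ltxx.
  apply/countable_injP; exists (pickle \o q) => t t' Et Et' /(pcan_inj pickleK).
  exact: qinj.
exists E => // t /andP[t0 tL] nE; apply: derive_left_slope => // q ql.
have [p] := rat_in_itvoo ql; rewrite in_itv/= => /andP[qp pl].
apply: contrapT => ny; apply: nE; split; first by rewrite t0.
exists p; split => // y ty.
rewrite leNgt; apply/negP => py; apply: ny; exists y => //.
exact: lt_trans py.
Qed.

Let mw a b : 0 <= a -> b <= L -> measurable_fun (`]a, b[ : set (measurableTypeR R)) left_slope.
Proof.
move=> a0 bL; apply: nonincreasing_on_measurable.
move=> x y; rewrite !inE/= !in_itv/= => /andP[ax xb] /andP[ay yb].
rewrite le_eqVlt => /predU1P[->//|xy]; apply/ltW/left_slope_decr => //.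
- exact: le_lt_trans ax.
- exact: lt_le_trans bL.
Qed.


Let w0 (D : set R) t : D `<=` `]0, L[ -> D t -> (0 <= (left_slope t)%:E)%E.
Proof.
move=> DL /DL/=; rewrite in_itv/= => /andP[t0 tL].
by rewrite lee_fin ltW// left_slope_gt0.
Qed.

Let mwD (D : set R) : measurable (D : set (measurableTypeR R)) -> D `<=` `]0, L[ ->
  measurable_fun (D : set (measurableTypeR R)) (EFin \o left_slope).
Proof.
move=> mD DL; apply/measurable_EFinP; apply: measurable_funS DL _ => //.
exact: mw.
Qed.

Let integral_le_left (D : set R) x : measurable (D : set (measurableTypeR R)) ->
  0 < x -> D `<=` `]x, L[ ->
  (\int[mu]_(t in D) (left_slope t)%:E <= (left_slope x)%:E * mu D)%E.
Proof.
move=> mD x0 DxL.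
have DL : D `<=` `]0, L[.
  by move=> t /DxL; rewrite /= !in_itv/= => /andP[/(lt_trans x0) -> ->].
rewrite -integral_cst//; apply: ge0_le_integral => //.
- by move=> t; exact: w0.
- exact: mwD.
- move=> t Dt; have := DxL _ Dt; rewrite /= in_itv/= => /andP[xt tL].
  by rewrite lee_fin ltW// left_slope_decr.
Qed.

(** On [a/2, a] the left derivative is at most the slope of phi over [a/4, a/2], so
    its integral over [a/2, a] is at most twice an increment of phi; the increments
    telescope. *)
Let dyadic_bound n :
  (\int[mu]_(t in `](L / 2 ^+ n.+1)%R, L[) (left_slope t)%:E <=
   (2 * (phi L - phi (L / 2 ^+ n.+2)))%:E)%E.
Proof.
pose a k := L / 2 ^+ k.
have aS k : a k = 2 * a k.+1.
  by rewrite /a exprS; field; rewrite expf_neq0.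
have a0 k : 0 < a k by rewrite divr_gt0// exprn_gt0.
have aL k : a k <= L by rewrite ler_pdivrMr ?exprn_gt0// ler_peMr ?exprn_ege1 ?ler1n// ltW.
have aSL k : a k.+1 < L by have := a0 k.+1; have := aL k; have := aS k; lra.
have phiL x : 0 <= x -> x <= L -> phi x <= phi L.
  by rewrite [x <= L]le_eqVlt => x0 /predU1P[->//|xL]; rewrite ltW// phi_incr.
(* D is ](a k.+1), (a k)[ up to its end points; the right one is excluded for
   k = 0, where it is L. *)
have step k (D : set R) : measurable (D : set (measurableTypeR R)) ->
    D `<=` `]a k.+1, L[ -> mu D = (a k.+1)%:E ->
    (\int[mu]_(t in D) (left_slope t)%:E <=
      (2 * (phi (a k.+1) - phi (a k.+2)))%:E)%E.
  move=> mD Da muD.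
  apply: le_trans (integral_le_left D _ mD (a0 k.+1) Da) _.
  rewrite muD -EFinM lee_fin.
  have := left_slope_le (a k.+2) (a k.+1) (ltW (a0 _)) _ (aSL _).
  have a2 : a k.+1 - a k.+2 = a k.+2 by have := aS k.+1; lra.
  have -> : a k.+2 < a k.+1 by have := a0 k.+2; have := aS k.+1; lra.
  move=> /(_ isT)/(ler_wpM2r (ltW (a0 k.+1)))/le_trans; apply.
  rewrite /slope a2; set X := phi _ - phi _; rewrite (aS k.+1).
  by rewrite (_ : X / _ * _ = 2 * X)//; field; rewrite gt_eqF.
rewrite -/(a n.+1) -/(a n.+2).
elim: n => [|n ih].
  apply: le_trans (step 0%N _ _ _ _) _ => //.
    rewrite lebesgue_measure_itv/= lte_fin aSL -EFinB; congr _%:E.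
    by have := aS 0%N; rewrite {1}/a expr0 divr1 => ->; lra.
  by rewrite lee_fin ler_wpM2l// lerD2r; apply: phiL; [exact/ltW/a0|exact: aL].
have an : a n.+2 < a n.+1 by have := a0 n.+2; have := aS n.+1; lra.
have -> : `]a n.+2, L[%classic = (`]a n.+2, a n.+1] `|` `]a n.+1, L[ : set R).
  by rewrite -itv_bndbnd_setU ?bnd_simp ?aSL ?(ltW an).
rewrite ge0_integral_setU//=; last 3 first.
- apply: mwD; first exact: measurableU.
  by move=> t [|] /=; rewrite !in_itv/= => /andP[h1 h2]; have := aSL n; have := a0 n.+2; have := a0 n.+1; lra.
- by move=> t [|] /=; rewrite !in_itv/= => /andP[h1 h2]; rewrite lee_fin ltW// left_slope_gt0//; have := aSL n; have := a0 n.+2; have := a0 n.+1; lra.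
- apply/disj_setPS => y [/=]; rewrite 2!in_itv/= => /andP[_ yx] /andP[].
  by rewrite ltNge yx.
apply: le_trans (leeD (step n.+1 _ _ _ _) ih) _ => //.
- by move=> t; rewrite /= !in_itv/= => /andP[-> h2]; have := aSL n; lra.
- by rewrite lebesgue_measure_itv/= lte_fin an -EFinB; congr _%:E; have := aS n.+1; lra.
by rewrite -EFinD lee_fin; lra.
Qed.

(** The dyadic bounds are uniform, so monotone convergence reaches 0. *)
Lemma integrable_left_slope : mu.-integrable `]0, L[ (EFin \o left_slope).
Proof.
apply/integrableP; split; first exact: mwD.
pose F n := `](L / 2 ^+ n.+1), L[%classic : set (measurableTypeR R).
have a0 k : 0 < L / 2 ^+ k by rewrite divr_gt0// exprn_gt0.
have F0 n : F n `<=` `]0, L[.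
  by move=> t; rewrite /F /= !in_itv/= => /andP[/(lt_trans (a0 _)) -> ->].
have FU : \bigcup_n F n = `]0, L[%classic.
  apply/seteqP; split => [t [n _ /F0]//|t]; rewrite /= in_itv/= => /andP[t0 tL].
  have /cvgrPdist_lt/(_ (t / L)) : (2^-1 : R) ^+ n @[n --> \oo] --> (0 : R).
    by apply: cvg_expr; rewrite ger0_norm ?invr_ge0// invf_lt1// ltr1n.
  rewrite divr_gt0// => /(_ isT)/filter_ex[n].
  rewrite sub0r normrN ger0_norm ?exprn_ge0// ltr_pdivlMr// => nt.
  exists n => //; rewrite /F /= in_itv/= tL andbT; apply: le_lt_trans nt.
  rewrite exprVn mulrC ler_pM2r// exprS invfM ler_piMl ?invr_ge0 ?exprn_ge0//.
  by rewrite invf_le1// ler1n.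
have ndF : nondecreasing_seq F.
  apply/nondecreasing_seqP => n; rewrite subsetEset => t; rewrite /F /= !in_itv/=.
  move=> /andP[nt ->]; rewrite andbT; apply: le_lt_trans nt.
  rewrite ler_pM2l// lef_pV2 ?posrE ?exprn_gt0// [leRHS]exprS.
  by rewrite ler_peMl ?exprn_ge0// ler1n.
have := @ge0_nondecreasing_set_cvg_integral _ _ _ F (EFin \o left_slope) mu ndF
  (fun=> measurable_itv _) (fun n => mwD _ (measurable_itv _) (F0 n))
  (fun n t => w0 _ t (F0 n)).
rewrite FU => cvgF.
apply: (@le_lt_trans _ _ (2 * (phi L - phi 0))%:E); last by rewrite ltry.
rewrite (_ : (\int[mu]_(x in _) _)%E = (\int[mu]_(x in `]0%R, L[) (EFin \o left_slope) x)%E).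
  move/cvg_lim : (cvgF) => <- //; apply: lime_le; first by apply/cvg_ex; eexists; exact: cvgF.
  apply: nearW => n; apply: le_trans (dyadic_bound n) _.
  rewrite lee_fin ler_wpM2l// lerD2l lerN2 ltW// phi_incr//.
  rewrite ler_pdivrMr ?exprn_gt0// ler_peMr ?exprn_ege1 ?ler1n//; exact: ltW.
apply: eq_integral => t; rewrite inE/= in_itv/= => /andP[t0 tL].
by rewrite ger0_norm// ltW// left_slope_gt0.
Qed.

End ConcaveWeight.

(** * The primitive of a strictly decreasing weight *)

Section ConcavePrimitive.
Context {R : realType}.
Variables (w : R -> R) (L : R).
Hypothesis L0 : 0 < L.
Hypothesis w_decr : forall x y, 0 < x -> x < y -> y < L -> w y < w x.
Notation mu := (@lebesgue_measure R).
Hypothesis iw : mu.-integrable `]0, L[ (EFin \o w).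

Definition primitive (x : R) := \int[mu]_(t in `]0, x[) w t.

Let iwS a b : 0 <= a -> b <= L -> mu.-integrable `]a, b[ (EFin \o w).
Proof.
move=> a0 bL; apply: integrableS iw; rewrite //.
move=> t; rewrite /= !in_itv/= => /andP[at_ tb].
by rewrite (le_lt_trans a0)//= (lt_le_trans tb).
Qed.

Let primitiveB x y : 0 <= x -> x < y -> y <= L ->
  primitive y - primitive x = \int[mu]_(t in `]x, y[) w t.
Proof.
move=> x0 xy yL; rewrite /primitive.
rewrite (@Rintegral_itv_bndo_bndc _ (BRight 0) x); last first.
  by apply: iwS => //; rewrite ltW// (lt_le_trans xy).
by rewrite Rintegral_itvB ?bnd_simp//; exact: iwS.
Qed.

Let meas_itv (a b : R) : a < b -> fine (mu (`]a, b[%classic : set R)) = b - a.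
Proof. by move=> ab; rewrite lebesgue_measure_itv/= lte_fin ab. Qed.

Let integrable_cst_itv (c a b : R) : mu.-integrable `]a, b[ (EFin \o (fun=> c)).
Proof.
apply: (@integrableS _ _ _ mu `[a, b]) => //; first exact: subset_itv_oo_cc.
apply: continuous_compact_integrable; first exact: segment_compact.
by apply: continuous_subspaceT => t; exact: cvg_cst.
Qed.

Let primitive_ge x y : 0 <= x -> x < y -> y < L ->
  w y * (y - x) <= primitive y - primitive x.
Proof.
move=> x0 xy yL; rewrite primitiveB//; last exact: ltW.
have -> : w y * (y - x) = \int[mu]_(t in `]x, y[) w y.
  by rewrite Rintegral_cst ?meas_itv//; exact: measurable_itv.
apply: le_Rintegral => //.
- by apply: iwS => //; exact: ltW.
- move=> t; rewrite /= in_itv/= => /andP[xt ty].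
  by rewrite ltW// w_decr// (le_lt_trans x0).
Qed.

Let primitive_le x y : 0 < x -> x < y -> y <= L ->
  primitive y - primitive x <= w x * (y - x).
Proof.
move=> x0 xy yL; rewrite primitiveB//; last exact: ltW.
have -> : w x * (y - x) = \int[mu]_(t in `]x, y[) w x.
  by rewrite Rintegral_cst ?meas_itv//; exact: measurable_itv.
apply: le_Rintegral => //.
- by apply: iwS => //; exact: ltW.
- move=> t; rewrite /= in_itv/= => /andP[xt ty].
  by rewrite ltW// w_decr// (lt_le_trans ty).
Qed.

Lemma primitive0 : primitive 0 = 0.
Proof. by rewrite /primitive set_itv_ge ?bnd_simp ?ltxx// Rintegral_set0. Qed.

(** The mean of w over ]a, x[ is at least w x, and that over ]x, b[ at most w x. *)
Let chord a x b : 0 <= a -> a < x -> x < b -> b <= L ->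
  (x - a) * (primitive b - primitive x) <= (b - x) * (primitive x - primitive a).
Proof.
move=> a0 ax xb bL.
have h1 := primitive_ge a x a0 ax (lt_le_trans xb bL).
have h2 := primitive_le x b (le_lt_trans a0 ax) xb bL.
have ax' : 0 <= x - a by rewrite subr_ge0 ltW.
have xb' : 0 <= b - x by rewrite subr_ge0 ltW.
have := ler_wpM2l ax' h2; have := ler_wpM2l xb' h1; lra.
Qed.

(** The primitive lies above the chords joining its values at 0, L/2 and
    L, and by strict monotonicity of w the middle point is strictly above the
    chord from 0 to L. *)
Lemma primitive_gap : exists2 kappa, 0 < kappa & forall x, 0 <= x <= L ->
  primitive L / L * x + kappa * Num.min x (L - x) <= primitive x.
Proof.
(* kappa is the height of the tent with apex at H, divided by H *)
pose H := L / 2.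
have H0 : 0 < H by rewrite divr_gt0.
have HL : H < L by rewrite ltr_pdivrMr// ltr_pMr// ltr1n.
have HH : H / 2 < H by rewrite ltr_pdivrMr// ltr_pMr// ltr1n.
have HH0 : 0 < H / 2 by rewrite divr_gt0.
set A := primitive H; set c := primitive L.
have h1 := primitive_ge 0 (H / 2) (lexx _) HH0 (lt_trans HH HL).
have h2 := primitive_ge (H / 2) H (ltW HH0) HH HL.
have h3 := primitive_le H L H0 HL (lexx _).
have h4 : w H < w (H / 2) by apply: w_decr.
rewrite primitive0 in h1.
have gap : 0 < 2 * A - c.
  have : w H * (H / 2) < w (H / 2) * (H / 2) by rewrite ltr_pM2r// divr_gt0.
  have LH : L - H = H by rewrite /H; lra.
  move: h1 h2 h3; rewrite LH -/A -/c; lra.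
exists ((2 * A - c) / L); first by rewrite divr_gt0.
move=> x /andP[x0 xL].
have -> : c / L * x + (2 * A - c) / L * Num.min x (L - x) =
   (c * x + (2 * A - c) * Num.min x (L - x)) / L by ring.
rewrite ler_pdivrMr//.
have [xH|Hx] := leP x H.
  have -> : Num.min x (L - x) = x by apply: min_l; rewrite /H in xH; lra.
  move: x0; rewrite le_eqVlt => /predU1P[<-|x0].
    by rewrite primitive0; lra.
  move: xH; rewrite le_eqVlt => /predU1P[->|xH].
    by rewrite /A /H; lra.
  have := chord 0 x H (lexx _) x0 xH (ltW HL).
  rewrite primitive0 /A /H; lra.
have -> : Num.min x (L - x) = L - x by apply: min_r; rewrite /H in Hx; lra.
move: xL; rewrite le_eqVlt => /predU1P[->|xL].
  by rewrite /c; lra.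
have := chord H x L (ltW H0) Hx xL (lexx _).
rewrite -/A -/c /H; lra.
Qed.

Hypothesis w_gt0 : forall x, 0 < x -> x < L -> 0 < w x.

Lemma primitive_ndecr x y : 0 <= x -> x <= y -> y <= L -> primitive x <= primitive y.
Proof.
move=> x0 + yL; rewrite le_eqVlt => /predU1P[->//|xy].
rewrite -subr_ge0 primitiveB//; apply: Rintegral_ge0 => t.
rewrite /= in_itv/= => /andP[xt ty]; rewrite ltW// w_gt0//.
  exact: le_lt_trans xt.
exact: lt_le_trans yL.
Qed.

Lemma primitive_gt0 : 0 < primitive L.
Proof.
have H0 : 0 < L / 2 by rewrite divr_gt0.
have HL : L / 2 < L by rewrite ltr_pdivrMr// ltr_pMr// ltr1n.
apply: lt_le_trans (primitive_ndecr (L / 2) L (ltW H0) (ltW HL) (lexx _)).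
have := primitive_ge 0 (L / 2) (lexx _) H0 HL.
rewrite primitive0 !subr0; apply: lt_le_trans.
by rewrite mulr_gt0// w_gt0.
Qed.

End ConcavePrimitive.

(** * Layer-cake formulas *)

Section LayerCake.
Context {R : realType}.
Notation mu := (@lebesgue_measure R).

(** Tonelli's theorem for the function p on the region E.  With p = 1 it gives the
    layer-cake formula for an integral; with p the weight, that for a
    Lorentz norm. *)
Lemma tonelli_region (D : set R) (p : R -> R) (E : set (measurableTypeR R * measurableTypeR R)) :
  measurable (D : set (measurableTypeR R)) ->
  measurable_fun (D : set (measurableTypeR R)) p -> (forall t, D t -> 0 <= p t) ->
  measurable E ->
  (\int[mu]_(t in D) ((p t)%:E * mu (xsection E t)) =
   \int[mu]_s \int[mu]_(t in D `&` ysection E s) (p t)%:E)%E.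
Proof.
move=> mD mp p0 mE.
pose q := p \_ D.
have q0 t : 0 <= q t.
  by rewrite /q patchE; case: ifPn => // /set_mem; exact: p0.
have mq : measurable_fun [set: measurableTypeR R] q.
  by apply/(measurable_restrictT _ mD).
pose F (x : measurableTypeR R * measurableTypeR R) := ((q x.1)%:E * (\1_E x)%:E)%E.
have mF : measurable_fun setT F.
  apply: emeasurable_funM; apply/measurable_EFinP.
    exact: measurableT_comp.
  exact: measurable_indic.
have F0 x : (0 <= F x)%E by rewrite mule_ge0 ?lee_fin.
have inner t : (\int[mu]_s F (t, s) = (q t)%:E * mu (xsection E t))%E.
  have mt : measurable_fun [set: measurableTypeR R] (fun s => (\1_E (t, s) : R)%:E).
    apply/measurable_EFinP.
    have mi : measurable_fun setT (\1_E : _ -> R) by exact: measurable_indic.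
    exact: (measurableT_comp mi (pair1_measurable t)).
  have q0t : (0 <= (q t)%:E)%E by rewrite lee_fin.
  rewrite (@ge0_integralZl _ _ _ mu setT measurableT _ mt _ (fun _ _ => _) q0t)//.
  congr (_ * _)%E.
  rewrite -[RHS]mul1e -integral_cst//; last exact: measurable_xsection.
  rewrite [in RHS]integral_mkcond.
  by apply: eq_integral => y _ /=; rewrite patchE mem_xsection indicE; case: ifPn.
have := fubini_tonelli F mF F0 (m1 := mu) (m2 := mu).
under eq_integral do rewrite inner.
rewrite [X in X = _ -> _](_ : _ = (\int[mu]_(t in D) ((p t)%:E * mu (xsection E t)))%E); last first.
  rewrite [RHS]integral_mkcond; apply: eq_integral => t _.
  by rewrite /q !patchE; case: ifPn => // _; rewrite mul0e.
move=> ->; apply: eq_integral => s _; rewrite [RHS]integral_mkcond.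
apply: eq_integral => t _; rewrite /F /q /patch /= in_setI mem_ysection indicE.
by case: (t \in D); case: (_ \in E); rewrite /= ?mule1 ?mule0 ?mul0e.
Qed.

Variable L : R.
Hypothesis L0 : 0 < L.
Implicit Types v : R -> R.

Let D : set R := `[0, L[.

Definition distribution_fun v (s : R) : R := fine (mu (D `&` [set t | s < v t])).

Section OneFunction.
Variable v : R -> R.
Hypothesis mv : measurable_fun [set: measurableTypeR R] v.

Let mD : measurable (D : set (measurableTypeR R)). Proof. exact: measurable_itv. Qed.

Let muD : mu D = L%:E.
Proof. by rewrite lebesgue_measure_itv/= lte_fin L0 sube0. Qed.

Let msup s : measurable (D `&` [set t | s < v t] : set (measurableTypeR R)).
Proof.
apply: measurableI => //.
have := mv measurableT `]s, +oo[%classic (measurable_itv _); rewrite setTI.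
by congr measurable; apply/seteqP; split => t; rewrite /= in_itv/= andbT.
Qed.

Lemma distribution_funE s : (distribution_fun v s)%:E = mu (D `&` [set t | s < v t]).
Proof.
rewrite /distribution_fun fineK// ge0_fin_numE//.
apply: (@le_lt_trans _ _ (mu D)); first by apply: le_measure; rewrite ?inE//; exact: subIsetl.
by rewrite muD ltry.
Qed.

Lemma distribution_fun_bounds s : 0 <= distribution_fun v s <= L.
Proof.
rewrite -!lee_fin distribution_funE measure_ge0/= -muD.
by apply: le_measure; rewrite ?inE//; exact: subIsetl.
Qed.

Lemma distribution_fun_decr s s' : s <= s' -> distribution_fun v s' <= distribution_fun v s.
Proof.
move=> ss'; rewrite -lee_fin !distribution_funE; apply: le_measure; rewrite ?inE//.
by move=> t [Dt /= s't]; split => //=; exact: le_lt_trans s't.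
Qed.

Lemma measurable_distribution_fun :
  measurable_fun [set: measurableTypeR R] (distribution_fun v).
Proof.
by apply: nonincreasing_measurable => // s s'; exact: distribution_fun_decr.
Qed.

(** Tonelli's theorem on the region below the graph of v. *)
Lemma layer_cake : (forall t, 0 <= v t) ->
  (\int[mu]_(t in D) (v t)%:E = \int[mu]_(s in `[0%R, +oo[) (distribution_fun v s)%:E)%E.
Proof.
move=> v0.
pose E : set (measurableTypeR R * measurableTypeR R) := [set x | 0 <= x.2 /\ x.2 < v x.1].
have mE : measurable E.
  rewrite (_ : E = (fun x => 0 <= x.2) @^-1` [set true] `&`
     (fun x => x.2 < v x.1) @^-1` [set true])//.
  apply: measurableI; rewrite -[X in measurable X]setTI.
    have : measurable_fun setT (fun x : measurableTypeR R * measurableTypeR R => 0 <= x.2).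
      exact: measurable_fun_ler.
    exact.
  have : measurable_fun setT (fun x : measurableTypeR R * measurableTypeR R => x.2 < v x.1).
    by apply: measurable_fun_ltr => //; exact: measurableT_comp.
  exact.
have := tonelli_region D (cst 1) E mD (@measurable_cst _ _ _ _ _ _) (fun _ _ => ler01) mE.
rewrite [X in X = _ -> _](_ : _ = (\int[mu]_(t in D) (v t)%:E)%E).
  move=> ->; rewrite [RHS]integral_mkcond; apply: eq_integral => s _.
  have -> : (\int[mu]_(t in D `&` ysection E s) (cst 1%R t)%:E =
      mu (D `&` ysection E s))%E.
    rewrite -[RHS]mul1e -integral_cst//; apply: measurableI => //.
    exact: measurable_ysection.
  rewrite patchE; case: ifPn => [|].
    rewrite inE/= in_itv/= andbT => s0; rewrite distribution_funE; congr (mu _).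
    apply/seteqP; split => t [Dt]; rewrite /ysection /= ?inE => H; split => //.
    by case: H.
  rewrite notin_setE /= in_itv/= andbT => s0.
  rewrite (_ : _ `&` _ = set0) ?measure0//; apply/seteqP; split => // t [_].
  by rewrite /ysection /= inE => -[].
apply: eq_integral => t _; rewrite mul1e.
rewrite (_ : xsection E t = `[0, v t[%classic); last first.
  apply/seteqP; split => s; rewrite /xsection /= in_itv/=.
    by rewrite inE => -[-> ->].
  by move=> /andP[s0 sv]; rewrite inE.
rewrite lebesgue_measure_itv/= lte_fin; case: ifPn; first by rewrite sube0.
by rewrite -leNgt => vt; congr _%:E; apply/eqP; rewrite eq_le v0.
Qed.

Definition decreasing_rearrangement (t : R) : \bar R :=
  ereal_inf [set s%:E | s in [set s | 0 <= s /\ distribution_fun v s <= t]].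

(** The distribution function decreases, so this set is an interval from 0 to the
    infimum of its complement. *)
Lemma measure_superlevel (t : R) :
  mu [set s | 0 <= s /\ t < distribution_fun v s] = decreasing_rearrangement t.
Proof.
set S := [set s | _].
have Sdown s s' : S s' -> 0 <= s -> s <= s' -> S s.
  move=> [s'0 ts'] s0 ss'; split => //.
  exact: lt_le_trans ts' (distribution_fun_decr _ _ ss').
have [[s0 [s00 s0t]]|noS] := pselect (exists s, 0 <= s /\ distribution_fun v s <= t).
  pose C := [set s | 0 <= s /\ distribution_fun v s <= t].
  have C0 : C !=set0 by exists s0.
  have Clb : has_lbound C by exists 0 => s [].
  have -> : decreasing_rearrangement t = (inf C)%:E.
    by rewrite /decreasing_rearrangement -ereal_inf_EFin.
  have i0 : 0 <= inf C by apply: lb_le_inf => // s [].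
  have S1 : `[0, inf C[%classic `<=` S.
    move=> s; rewrite /= in_itv/= => /andP[sp si]; split => //.
    rewrite ltNge; apply/negP => sC.
    by move: si; rewrite ltNge => /negP; apply; exact: ge_inf.
  have S2 : S `<=` `[0, inf C].
    move=> s [sp ts]; rewrite /= in_itv/= sp; apply: lb_le_inf => // s' [s'0 s't].
    rewrite leNgt; apply/negP => /ltW/distribution_fun_decr.
    by rewrite leNgt (le_lt_trans s't ts).
  have mS : measurable (S : set (measurableTypeR R)).
    apply: is_interval_measurable => x y Sx Sy z /andP[xz zy].
    apply: (Sdown _ y) => //; case: Sx => x0 _; exact: le_trans xz.
  have mu1 : mu (`[0, inf C[%classic : set R) = (inf C)%:E.
    rewrite lebesgue_measure_itv/= lte_fin; case: ifPn => [|]; first by rewrite sube0.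
    by rewrite -leNgt => ?; congr _%:E; apply/eqP; rewrite eq_le i0.
  have mu2 : mu (`[0, inf C]%classic : set R) = (inf C)%:E.
    rewrite lebesgue_measure_itv/= lte_fin; case: ifPn => [|]; first by rewrite sube0.
    by rewrite -leNgt => ?; congr _%:E; apply/eqP; rewrite eq_le i0.
  apply/eqP; rewrite eq_le; apply/andP; split.
    by rewrite -mu2; apply: le_measure; rewrite ?inE//; exact: measurable_itv.
  by rewrite -mu1; apply: le_measure; rewrite ?inE//; exact: measurable_itv.
have -> : S = `[0, +oo[%classic.
  apply/seteqP; split => s; rewrite /= in_itv/= andbT; first by case.
  move=> s0; split => //; rewrite ltNge; apply/negP => st; apply: noS.
  by exists s.
rewrite lebesgue_measure_itv/= ltry /decreasing_rearrangement.
rewrite (_ : [set s | _] = set0) ?image_set0 ?ereal_inf0//.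
by apply/seteqP; split => // s ?; apply: noS; exists s.
Qed.

End OneFunction.
End LayerCake.

(** * Stability of the comparison with the L^1 norm *)

Section LorentzStability.
Context {R : realType}.
Notation mu := (@lebesgue_measure R).
Variables (L : R) (w : R -> R).
Hypothesis L0 : 0 < L.
Hypothesis w_decr : forall x y, 0 < x -> x < y -> y < L -> w y < w x.
Hypothesis w_gt0 : forall x, 0 < x -> x < L -> 0 < w x.
Hypothesis iw : mu.-integrable `]0, L[ (EFin \o w).

Let c := primitive w L.
Notation dist := (distribution_fun L).

Definition rearrangement_integral (v : R -> R) : \bar R :=
  (\int[mu]_(t in `]0%R, L[) (decreasing_rearrangement L v t * (w t)%:E))%E.

Let mD : measurable (`[0, L[%classic : set (measurableTypeR R)).
Proof. exact: measurable_itv. Qed.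

Let mI : measurable (`[0, +oo[%classic : set (measurableTypeR R)).
Proof. exact: measurable_itv. Qed.

Let mw : measurable_fun (`]0, L[%classic : set (measurableTypeR R)) w.
Proof. by have /integrableP[/measurable_EFinP] := iw. Qed.

Let c0 : 0 < c. Proof. exact: (primitive_gt0 w L L0 w_decr iw w_gt0). Qed.

Section OneFunction.
Variable v : R -> R.
Hypothesis mv : measurable_fun [set: measurableTypeR R] v.
Hypothesis v0 : forall t, 0 <= v t.

Let d01 s := distribution_fun_bounds L L0 v mv s.
Let md := measurable_distribution_fun L L0 v mv.

Let E : set (measurableTypeR R * measurableTypeR R) :=
  [set x | 0 <= x.2 /\ x.1 < dist v x.2].

Let mE : measurable E.
Proof.
rewrite (_ : E = (fun x => 0 <= x.2) @^-1` [set true] `&`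
   (fun x => x.1 < dist v x.2) @^-1` [set true])//.
apply: measurableI; rewrite -[X in measurable X]setTI.
  have : measurable_fun setT (fun x : measurableTypeR R * measurableTypeR R => 0 <= x.2).
    exact: measurable_fun_ler.
  exact.
have : measurable_fun setT (fun x : measurableTypeR R * measurableTypeR R => x.1 < dist v x.2).
  by apply: measurable_fun_ltr => //; exact: measurableT_comp.
exact.
Qed.

Let rearrangementE t : decreasing_rearrangement L v t = mu (xsection E t).
Proof.
rewrite -(measure_superlevel L L0 v mv); congr (mu _).
by apply/seteqP; split => s; rewrite /xsection /= inE.
Qed.

Lemma measurable_rearrangement :
  measurable_fun [set: measurableTypeR R] (decreasing_rearrangement L v).
Proof.
rewrite (_ : decreasing_rearrangement L v = mu \o xsection E).
  exact: measurable_fun_xsection.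
by apply/funext => t; exact: rearrangementE.
Qed.

Lemma rearrangement_ge0 t : (0 <= decreasing_rearrangement L v t)%E.
Proof. by rewrite rearrangementE. Qed.

(** Tonelli's theorem on the region t < d s, whose sections are intervals
    of lengths v^* t and d s. *)
Lemma lorentz_layer_cake : rearrangement_integral v =
  (\int[mu]_(s in `[0%R, +oo[) (primitive w (dist v s))%:E)%E.
Proof.
have w0 t : `]0, L[%classic t -> 0 <= w t.
  by rewrite /= in_itv/= => /andP[t0 tL]; rewrite ltW// w_gt0.
have := tonelli_region `]0, L[%classic w E (measurable_itv _) mw w0 mE.
rewrite [X in X = _ -> _](_ : _ = rearrangement_integral v).
  move=> ->; rewrite [RHS]integral_mkcond; apply: eq_integral => s _.
  rewrite /patch; case: ifPn.
    rewrite inE/= in_itv/= andbT => s0; have /andP[ds0 dsL] := d01 s.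
    have -> : (`]0, L[%classic `&` ysection E s = `]0, dist v s[%classic :> set R).
      apply/seteqP; split => t; rewrite /ysection /= !in_itv/= ?inE.
        by move=> [/andP[-> _] []].
      by move=> /andP[t0 td]; rewrite t0 (lt_le_trans td).
    rewrite /primitive /Rintegral fineK//; apply: integrable_fin_num => //.
    apply: integrableS iw => //.
    by move=> t; rewrite /= !in_itv/= => /andP[-> td]; rewrite (lt_le_trans td).
  rewrite notin_setE /= in_itv/= andbT => s0.
  rewrite (_ : _ `&` _ = set0) ?integral_set0//; apply/seteqP; split => // t [_].
  by rewrite /ysection /= inE => -[].
by apply: eq_integral => t _; rewrite muleC rearrangementE.
Qed.

Let meas_EFin (F : R -> R) : measurable_fun [set: measurableTypeR R] F ->
  measurable_fun (`[0, +oo[%classic : set (measurableTypeR R)) (EFin \o F).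
Proof. by move=> mF; apply/measurable_EFinP; exact: measurable_funTS. Qed.

(** The levels s at which the set where v exceeds s is neither null nor conull
    are the obstruction to v being constant. *)
Definition mid_level_integral : \bar R :=
  (\int[mu]_(s in `[0%R, +oo[) (Num.min (dist v s) (L - dist v s))%:E)%E.

Let mmin : measurable_fun [set: measurableTypeR R]
  (fun s => Num.min (dist v s) (L - dist v s)).
Proof. by apply: measurable_minr => //; exact: measurable_funB. Qed.

Let min0 s : 0 <= Num.min (dist v s) (L - dist v s).
Proof. by have /andP[d0 dL] := d01 s; rewrite le_min d0 subr_ge0. Qed.

Lemma rearrangement_integral_le (M : R) : (forall t, v t <= M) ->
  (rearrangement_integral v <= (M * c)%:E)%E.
Proof.
move=> vM; have M0 : 0 <= M by apply: le_trans (vM 0).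
have w0 t : `]0, L[%classic t -> (0 <= (w t)%:E)%E.
  by rewrite /= in_itv/= => /andP[t0 tL]; rewrite lee_fin ltW// w_gt0.
have mwE : measurable_fun (`]0, L[%classic : set (measurableTypeR R)) (EFin \o w).
  exact/measurable_EFinP.
have M0E : (0 <= M%:E)%E by rewrite lee_fin.
rewrite EFinM /c /primitive /Rintegral fineK; last exact: integrable_fin_num.
rewrite -(@ge0_integralZl _ _ _ mu _ (measurable_itv _) _ mwE _ w0 M0E).
apply: ge0_le_integral => //.
- by move=> t tI; rewrite mule_ge0 ?rearrangement_ge0// w0.
- apply: emeasurable_funM => //.
  by apply: measurable_funTS; exact: measurable_rearrangement.
- exact: measurable_funeM.
move=> t tI; apply: lee_wpmul2r; first exact: w0.
apply: ereal_inf_lbound; exists M => //; split => //.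
rewrite /distribution_fun (_ : _ `&` _ = set0) ?measure0.
  by move: tI; rewrite /= in_itv/= => /andP[/ltW].
by apply/seteqP; split => // s [_] /=; rewrite ltNge vM.
Qed.

Let mdE := meas_EFin _ md.
Let mminE := meas_EFin _ mmin.

Let d0E s : (0 <= (dist v s)%:E)%E.
Proof. by rewrite lee_fin; have /andP[] := d01 s. Qed.

Let min0E s : (0 <= (Num.min (dist v s) (L - dist v s))%:E)%E.
Proof. by rewrite lee_fin. Qed.

Let mprim : measurable_fun [set: measurableTypeR R] (fun s => primitive w (dist v s)).
Proof.
apply: nonincreasing_measurable => // s s' ss'.
have /andP[d0 dL] := d01 s; have /andP[d0' dL'] := d01 s'.
apply: (primitive_ndecr w L iw w_gt0) => //.
exact: distribution_fun_decr.
Qed.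

(** The gap inequality for the primitive at x = d s, integrated over the levels. *)
Lemma lorentz_gap kappa : 0 <= kappa -> (forall x, 0 <= x <= L ->
    c / L * x + kappa * Num.min x (L - x) <= primitive w x) ->
  ((c / L)%:E * \int[mu]_(t in `[0%R, L[) (v t)%:E + kappa%:E * mid_level_integral
    <= rearrangement_integral v)%E.
Proof.
move=> k0 gap; rewrite (layer_cake L L0 v mv v0) lorentz_layer_cake.
have cL0 : (0 <= (c / L)%:E)%E by rewrite lee_fin divr_ge0// ltW.
have k0E : (0 <= kappa%:E)%E by rewrite lee_fin.
rewrite -(@ge0_integralZl _ _ _ mu _ mI _ mdE _ (fun s _ => d0E s) cL0).
rewrite -(@ge0_integralZl _ _ _ mu _ mI _ mminE _ (fun s _ => min0E s) k0E).
rewrite -ge0_integralD//; last 4 first.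
- by move=> s _; rewrite mule_ge0//; exact: d0E.
- exact: (measurable_funeM _ mdE).
- by move=> s _; rewrite mule_ge0//; exact: min0E.
- exact: (measurable_funeM _ mminE).
apply: ge0_le_integral => //.
- by move=> s _; rewrite adde_ge0// mule_ge0//; [exact: d0E|exact: min0E].
- by apply: emeasurable_funD; [exact: (measurable_funeM _ mdE)|exact: (measurable_funeM _ mminE)].
- exact: meas_EFin.
- by move=> s _ /=; rewrite -!EFinM -EFinD lee_fin; exact: gap.
Qed.

End OneFunction.

Let m0m (m : R) : measurable (`[0, m[%classic : set (measurableTypeR R)).
Proof. exact: measurable_itv. Qed.

Let indic_level (m : R) : 0 <= m ->
  (\int[mu]_(s in `[0%R, +oo[) (L%:E * (\1_(`[0%R, m[%classic : set R) s)%:E) = (L * m)%:E)%E.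
Proof.
move=> m0.
have mi : measurable_fun (`[0, +oo[%classic : set (measurableTypeR R))
    (fun s => (\1_(`[0%R, m[%classic : set R) s : R)%:E).
  by apply/measurable_EFinP; exact: (measurable_indic (m0m m)).
have L0E : (0 <= L%:E)%E by rewrite lee_fin ltW.
have i0 s : `[0, +oo[%classic s -> (0 <= (\1_(`[0%R, m[%classic : set R) s : R)%:E)%E.
  by rewrite lee_fin.
rewrite (@ge0_integralZl _ _ _ mu _ mI _ mi _ i0 L0E) integral_indic//.
have -> : `[0%R, m[%classic `&` `[0, +oo[ = `[0, m[%classic :> set R.
  apply/seteqP; split => s; rewrite /= !in_itv/= ?andbT.
    by move=> [/andP[-> ->]].
  by move=> /andP[-> ->].
have Em : mu (`[0, m[%classic : set R) = m%:E.
  rewrite lebesgue_measure_itv/= lte_fin; case: ifPn; first by rewrite sube0.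
  by rewrite -leNgt => m0'; congr _%:E; apply/eqP; rewrite eq_le m0.
by rewrite EFinM -Em.
Qed.

Let mindic (m : R) : measurable_fun (`[0, +oo[%classic : set (measurableTypeR R))
  (fun s => (L%:E * (\1_(`[0%R, m[%classic : set R) s)%:E)%E).
Proof.
apply: measurable_funeM; apply/measurable_EFinP.
exact: (measurable_indic (m0m m)).
Qed.

Let indic_ge0 (m s : R) : (0 <= L%:E * (\1_(`[0%R, m[%classic : set R) s)%:E)%E.
Proof. by rewrite mule_ge0// lee_fin// ltW. Qed.

Let integrable_continuous (F : R -> R) : continuous F -> mu.-integrable `[0, L[ (EFin \o F).
Proof.
move=> cF; apply: (@integrableS _ _ _ mu `[0, L]) => //; first exact: subset_itv_co_cc.
apply: continuous_compact_integrable; first exact: segment_compact.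
exact: continuous_subspaceT.
Qed.

Let dist_max v (m s : R) : continuous v -> 0 <= s ->
  dist (fun t => Num.max (v t) m) s = if s < m then L else dist v s.
Proof.
move=> cv s0; rewrite /distribution_fun; case: ifPn => sm.
  rewrite (_ : _ `&` _ = `[0, L[%classic); first by rewrite lebesgue_measure_itv/= lte_fin L0 sube0.
  by apply/seteqP; split => t; [case|move=> Dt; split => //=; rewrite lt_max sm orbT].
congr (fine (mu _)); congr (_ `&` _); apply/seteqP; split => t /=.
  by rewrite lt_max (negbTE sm) orbF.
by rewrite lt_max => ->.
Qed.

Let dist_min v (m s : R) : continuous v ->
  dist (fun t => Num.min (v t) m) s = if s < m then dist v s else 0.
Proof.
move=> cv; rewrite /distribution_fun; case: ifPn => sm.
  congr (fine (mu _)); congr (_ `&` _); apply/seteqP; split => t /=.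
    by rewrite lt_min sm andbT.
  by rewrite lt_min sm andbT.
rewrite (_ : _ `&` _ = set0) ?measure0//.
by apply/seteqP; split => // t [_] /=; rewrite lt_min (negbTE sm) andbF.
Qed.

(** The L^1 norm of v - m is the sum of the integrals of its positive part P and its
    negative part N.  If d m <= L/2 then P is the integral over s > m of
    d s = min (d s) (L - d s); otherwise N is at most the integral over s < m of
    L - d s = min (d s) (L - d s).  So one of the two is at most K, and P - N is known.
    Truncating v at m by a maximum (by a minimum) isolates P (N). *)
Lemma deviation_le (v : R -> R) (m K : R) : continuous v -> (forall t, 0 <= v t) ->
  0 <= m -> (mid_level_integral v <= K%:E)%E ->
  \int[mu]_(t in `[0, L[) `|v t - m| <=
    2 * K + `|\int[mu]_(t in `[0, L[) v t - L * m|.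
Proof.
move=> cv v0 m0 vK.
have mv : measurable_fun [set: measurableTypeR R] v by exact: continuous_measurable_fun.
set X := \int[mu]_(t in _) v t.
have iv := integrable_continuous _ cv.
have ca : continuous (fun t => `|v t - m|).
  by move=> t; apply: cvg_norm; apply: cvgB; [exact: cv|exact: cvg_cst].
have ia := integrable_continuous _ ca.
have im : mu.-integrable `[0, L[ (EFin \o (fun=> m)).
  by apply: integrable_continuous => t; exact: cvg_cst.
have intm : \int[mu]_(t in `[0, L[) m = L * m.
  have muL : fine (mu (`[0, L[%classic : set R)) = L.
    by rewrite lebesgue_measure_itv/= lte_fin L0 sube0.
  by rewrite Rintegral_cst// mulrC -[in RHS]muL.
set Y := \int[mu]_(t in _) `|_|.
have d01 s := distribution_fun_bounds L L0 v mv s.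
have ddecr := distribution_fun_decr L L0 v mv.
have mmid : measurable_fun (`[0, +oo[%classic : set (measurableTypeR R))
    (fun s => (Num.min (dist v s) (L - dist v s))%:E).
  apply/measurable_EFinP/measurable_funTS; apply: measurable_minr.
    exact: measurable_distribution_fun.
  by apply: measurable_funB => //; exact: measurable_distribution_fun.
have mid0 s : (0 <= (Num.min (dist v s) (L - dist v s))%:E)%E.
  by have /andP[d0 dL] := d01 s; rewrite lee_fin le_min d0 subr_ge0.
have [small|large] := leP (dist v m) (L / 2).
- (* 2 (max v m) = |v - m| + v + m *)
  pose M t := Num.max (v t) m.
  have cM : continuous M.
    by move=> t; apply: continuous_max; [exact: cv|exact: cvg_cst].
  have M0 t : 0 <= M t by rewrite le_max v0.
  have mM : measurable_fun [set: measurableTypeR R] M by exact: continuous_measurable_fun.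
  have iM := integrable_continuous _ cM.
  have EM : 2 * \int[mu]_(t in `[0, L[) M t = Y + X + L * m.
    rewrite -RintegralZl// -intm -RintegralD// -RintegralD//; last first.
      exact: (integrableD mD ia iv).
    apply: eq_Rintegral => t _; rewrite /M.
    by have [vm|vm] := leP (v t) m; [rewrite ler0_norm ?subr_le0//|rewrite gtr0_norm ?subr_gt0//]; ring.
  have : (\int[mu]_(t in `[0%R, L[) (M t)%:E <= (L * m + K)%:E)%E.
    rewrite (layer_cake L L0 M mM M0) EFinD -(indic_level m m0).
    have mdM : measurable_fun (`[0, +oo[%classic : set (measurableTypeR R))
        (fun s => (dist M s)%:E).
      apply/measurable_EFinP/measurable_funTS; exact: measurable_distribution_fun.
    apply: (@le_trans _ _ (\int[mu]_(s in `[0%R, +oo[)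
      (L%:E * (\1_(`[0%R, m[%classic : set R) s)%:E + (Num.min (dist v s) (L - dist v s))%:E))%E).
      apply: ge0_le_integral => //.
      + by move=> s _; rewrite lee_fin; have /andP[] := distribution_fun_bounds L L0 M mM s.
      + exact: emeasurable_funD.
      + move=> s; rewrite /= in_itv/= andbT => s0.
        rewrite /M dist_max// indicE.
        case: ifPn => sm.
          rewrite mem_set/=; last by rewrite in_itv/= s0.
          by rewrite mule1 -EFinD lee_fin lerDl; rewrite -lee_fin.
        rewrite memNset/=; last by rewrite in_itv/= s0; exact/negP.
        rewrite mule0 add0e lee_fin le_min lexx/= lerBrDr.
        have : dist v s <= L / 2.
          by apply: le_trans small; apply: ddecr; rewrite leNgt.
        lra.
    rewrite ge0_integralD//; first exact: leeD.
  rewrite -(fineK (integrable_fin_num mD iM)) lee_fin -/(Rintegral _ _ _) => HM.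
  have := ler_norm (- (X - L * m)); rewrite normrN; lra.
- (* 2 (min v m) = v + m - |v - m| *)
  pose N t := Num.min (v t) m.
  have cN : continuous N.
    by move=> t; apply: continuous_min; [exact: cv|exact: cvg_cst].
  have N0 t : 0 <= N t by rewrite le_min v0.
  have mN : measurable_fun [set: measurableTypeR R] N by exact: continuous_measurable_fun.
  have iN := integrable_continuous _ cN.
  have EN : 2 * \int[mu]_(t in `[0, L[) N t + Y = X + L * m.
    rewrite -RintegralZl// -intm -!RintegralD//; last first.
      have := integrableZl mD 2 iN; by [].
    apply: eq_Rintegral => t _; rewrite /N.
    by have [vm|vm] := leP (v t) m; [rewrite ler0_norm ?subr_le0//|rewrite gtr0_norm ?subr_gt0//]; ring.
  have : ((L * m)%:E <= \int[mu]_(t in `[0%R, L[) (N t)%:E + K%:E)%E.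
    rewrite (layer_cake L L0 N mN N0) -(indic_level m m0).
    have mdN : measurable_fun (`[0, +oo[%classic : set (measurableTypeR R))
        (fun s => (dist N s)%:E).
      apply/measurable_EFinP/measurable_funTS; exact: measurable_distribution_fun.
    have dN0 s : (0 <= (dist N s)%:E)%E.
      by rewrite lee_fin; have /andP[] := distribution_fun_bounds L L0 N mN s.
    apply: (@le_trans _ _ (\int[mu]_(s in `[0%R, +oo[)
      ((dist N s)%:E + (Num.min (dist v s) (L - dist v s))%:E))%E).
      apply: ge0_le_integral => //.
      + exact: emeasurable_funD.
      + move=> s; rewrite /= in_itv/= andbT => s0.
        rewrite /N dist_min// indicE.
        case: ifPn => sm.
          rewrite mem_set/=; last by rewrite in_itv/= s0.
          rewrite mule1 -EFinD lee_fin min_r.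
            by rewrite addrC subrK.
          have : L / 2 < dist v s.
            by apply: lt_le_trans large _; apply: ddecr; rewrite ltW.
          lra.
        rewrite memNset/=; last by rewrite in_itv/= s0; exact/negP.
        by rewrite mule0 add0e.
    rewrite ge0_integralD//; exact: leeD.
  rewrite -(fineK (integrable_fin_num mD iN)) -EFinD lee_fin -/(Rintegral _ _ _) => HN.
  have := ler_norm (X - L * m); lra.
Qed.

(** The gap inequality bounds both the defect of the L^1 norm and the integral over
    the intermediate levels; the latter bounds the deviation from 1/c. *)
Lemma lorentz_stability : exists2 K, 0 <= K & forall v : R -> R,
  continuous v -> (forall t, 0 <= v t) -> (rearrangement_integral v <= 1)%E ->
  \int[mu]_(t in `[0, L[) v t <= L / c /\
  \int[mu]_(t in `[0, L[) `|v t - c^-1| <=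
    K * (L / c - \int[mu]_(t in `[0, L[) v t).
Proof.
have [kappa k0 gap] := primitive_gap w L L0 w_decr iw.
exists (2 * (c / L / kappa) + 1).
  by rewrite addr_ge0// mulr_ge0// divr_ge0 ?ltW// divr_gt0.
move=> v cv v0 v1.
have mv : measurable_fun [set: measurableTypeR R] v by exact: continuous_measurable_fun.
have iv := integrable_continuous _ cv.
have := le_trans (lorentz_gap v mv v0 kappa (ltW k0) gap) v1.
rewrite -(fineK (integrable_fin_num mD iv)) -/(Rintegral _ _ _).
set X := Rintegral _ _ _ => H.
have mid_ge0 : (0 <= mid_level_integral v)%E.
  apply: integral_ge0 => s _; have /andP[d0 dL] := distribution_fun_bounds L L0 v mv s.
  by rewrite lee_fin le_min d0 subr_ge0.
have midfin : mid_level_integral v \is a fin_num.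
  rewrite ge0_fin_numE// ltey; apply: contraTN H => /eqP ->.
  by rewrite gt0_muley ?lte_fin// addey// -ltNge ltry.
move: H; rewrite -(fineK midfin) -!EFinM -EFinD lee_fin.
set J := fine _ => H.
have J0 : 0 <= J by exact: fine_ge0.
have cL0 : 0 < c / L by rewrite divr_gt0.
have XL : X <= L / c.
  rewrite -(ler_pM2l cL0) (_ : c / L * (L / c) = 1); last first.
    by field; rewrite !gt_eqF.
  have : 0 <= kappa * J by rewrite mulr_ge0// ltW.
  lra.
split=> //.
have c10 : 0 <= c^-1 by rewrite invr_ge0 ltW.
have := deviation_le v c^-1 J cv v0 c10; rewrite fineK// lexx => /(_ isT)/le_trans; apply.
have -> : `|X - L * c^-1| = L / c - X by rewrite ler0_norm ?subr_le0// opprB.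
rewrite [leRHS]mulrDl mul1r lerD2r -[leRHS]mulrA ler_pM2l//.
rewrite -(ler_pM2l k0).
have -> : kappa * (c / L / kappa * (L / c - X)) = 1 - c / L * X.
  by field; rewrite !gt_eqF.
lra.
Qed.

End LorentzStability.

(** * Hardy-Lorentz norms *)

Section LorentzNorm.
Context {R : realType}.
Notation mu := (@lebesgue_measure R).
Variable phi : R -> R.
Let L : R := 2 * pi.
Hypothesis phi_incr : forall x y : R, 0 <= x -> x < y -> y <= L -> phi x < phi y.
Hypothesis phi_conc : strictly_concave_on `[0, L] phi.

Let L0 : 0 < L. Proof. by rewrite mulr_gt0 ?pi_gt0. Qed.
Let w := left_slope phi.
Let w_decr := left_slope_decr phi L phi_conc.
Let w_gt0 := left_slope_gt0 phi L phi_incr phi_conc.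
Let iw := integrable_left_slope phi L L0 phi_incr phi_conc.

Definition weight_mass : R := primitive (left_slope phi) (2 * pi).
Let c := weight_mass.
Let c0 : 0 < c. Proof. exact: (primitive_gt0 w L L0 w_decr iw w_gt0). Qed.

Lemma rearrangement_decreasing (f : R[i] -> R[i]) (t : R) :
  continuous (fun s => cmod (f (expi s))) ->
  rearrangement f t = decreasing_rearrangement L (fun s => cmod (f (expi s))) t.
Proof.
move=> cf; have mf := continuous_measurable_fun cf.
congr ereal_inf; congr image; apply/seteqP; split => s /=;
  rewrite -(lee_fin (distribution_fun _ _ _)) (distribution_funE _ L0 _ mf) /arc_length;
  rewrite (_ : [set t0 : R | _ /\ _] = `[0, L[%classic `&` [set t0 | s < cmod (f (expi t0))])//;
  by apply/seteqP; split => x /=; rewrite in_itv/=.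
Qed.

(** Measurability of phi' itself, whose conventional values outside a countable set
    are arbitrary: every function is measurable on a countable set. *)
Lemma measurable_off_countable (D E : set R) (f g : R -> \bar R) :
  measurable (D : set (measurableTypeR R)) -> countable E ->
  (forall t, D t -> ~ E t -> f t = g t) ->
  measurable_fun (D : set (measurableTypeR R)) g ->
  measurable_fun (D : set (measurableTypeR R)) f.
Proof.
move=> mD cE fg mg _ B mB.
have mE : measurable (E : set (measurableTypeR R)) by exact: countable_measurable.
rewrite (_ : D `&` f @^-1` B = ((D `&` g @^-1` B) `\` E) `|` (D `&` E `&` f @^-1` B)).
  apply: measurableU.
    by apply: measurableD => //; exact: mg.
  apply: countable_measurable => //.
  have sE : D `&` E `&` f @^-1` B `<=` E by move=> t [[_]].
  exact: sub_countable (subset_card_le sE) cE.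
apply/seteqP; split => [t [Dt Bft]|t [[[Dt Bgt] Et]|[[Dt Et] Bft]]].
- have [Et|Et] := pselect (E t); first by right.
  by left; split => //; split => //; rewrite /preimage /= -fg.
- by split => //; rewrite /preimage /= fg.
- by split.
Qed.

Lemma lorentz_normE (f : R[i] -> R[i]) : continuous (fun s => cmod (f (expi s))) ->
  lorentz_norm phi f = rearrangement_integral L w (fun s => cmod (f (expi s))).
Proof.
move=> cf; have mf := continuous_measurable_fun cf.
have [E cE HE] := derive_concave phi L phi_conc.
pose v s := cmod (f (expi s)).
pose G t := (decreasing_rearrangement L v t * (derive1 (phi : R -> R^o) t)%:E)%E.
pose H t := (decreasing_rearrangement L v t * (w t)%:E)%E.
have mI : measurable (`]0, L[%classic : set (measurableTypeR R)).
  exact: measurable_itv.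
have GH t : `]0, L[%classic t -> ~ E t -> G t = H t.
  by rewrite /= in_itv/= => tI Et; rewrite /G /H HE.
have mH : measurable_fun (`]0, L[%classic : set (measurableTypeR R)) H.
  apply: emeasurable_funM; last by case/integrableP : iw.
  by apply: measurable_funTS; exact: measurable_rearrangement.
have mG := measurable_off_countable _ _ _ _ mI cE GH mH.
transitivity (\int[mu]_(t in `[0%R, L]) G t)%E.
  by apply: eq_integral => t _; rewrite rearrangement_decreasing.
rewrite (integral_itv_bndoo _ _ mG).
apply: ae_eq_integral => //.
exists E; split.
- exact: countable_measurable.
- exact: countable_lebesgue_measure0.
- by move=> t /= /not_implyP[tI]; apply: contra_notP => Et; exact: GH.
Qed.


Let integrable_co (F : R -> R) : continuous F -> mu.-integrable `[0, L[ (EFin \o F).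
Proof.
move=> cF; apply: (@integrableS _ _ _ mu `[0, L]) => //; first exact: subset_itv_co_cc.
exact/integrable_circle.
Qed.

Let mco : measurable (`[0, L[%classic : set (measurableTypeR R)).
Proof. exact: measurable_itv. Qed.

Let Rint_co (F : R -> R) : continuous F ->
  \int[mu]_(t in `[0, L[) F t = \int[mu]_(t in `[0, L]) F t.
Proof.
move=> cF; apply: Rintegral_itv_bndo_bndc; exact: integrable_co.
Qed.

Let ccircle (u : R[i] -> R[i]) (r : R) : holomorphic u -> 0 <= r < 1 ->
  continuous (fun t => cmod (u (r%:C * expi t))).
Proof. by move=> hu r01; exact: (@continuous_circle R u (@cmod R) r hu r01 (@cmod_distr R)). Qed.

(** The rearrangement of a function bounded by M is bounded by M. *)
Lemma lorentz_norm_le (u : R[i] -> R[i]) (r M : R) : holomorphic u -> 0 <= r < 1 ->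
  (forall z, disc z -> cmod (u z) <= M) ->
  (lorentz_norm phi (dilate u r) <= (M * c)%:E)%E.
Proof.
move=> hu r01 uM; rewrite lorentz_normE; last exact: ccircle.
apply: (@rearrangement_integral_le R L w L0 w_gt0 iw).
- by apply: continuous_measurable_fun; exact: ccircle.
- by move=> t; exact: cmod_ge0.
- by move=> t; apply: uM; exact: polar_disc.
Qed.

Lemma circle_L1_le_lorentz (u : R[i] -> R[i]) (r : R) : holomorphic u -> 0 <= r < 1 ->
  ((c / L * circle_L1 u r)%:E <= lorentz_norm phi (dilate u r))%E.
Proof.
move=> hu r01; have cu := ccircle u r hu r01.
rewrite (lorentz_normE _ cu).
pose v t := cmod (u (r%:C * expi t)).
have mv : measurable_fun [set: measurableTypeR R] v by exact: continuous_measurable_fun.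
have v0 t : 0 <= v t by exact: cmod_ge0.
have [kappa k0 gap] := primitive_gap w L L0 w_decr iw.
apply: le_trans (lorentz_gap L w L0 w_decr w_gt0 iw v mv v0 kappa (ltW k0) gap).
have E : (circle_L1 u r)%:E = (\int[mu]_(t in `[0%R, L[) (v t)%:E)%E.
  rewrite -[RHS]fineK; last exact: (integrable_fin_num mco (integrable_co _ cu)).
  by rewrite /circle_L1 -(Rint_co _ cu).
rewrite (EFinM (c / L)) E.
rewrite leeDl//; apply: mule_ge0; first by rewrite lee_fin ltW.
apply: integral_ge0 => s _; have /andP[d0 dL] := distribution_fun_bounds L L0 v mv s.
by rewrite lee_fin le_min d0 subr_ge0.
Qed.

Lemma circle_stability : exists2 K, 0 <= K & forall (u : R[i] -> R[i]) (r : R),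
  holomorphic u -> 0 <= r < 1 -> (lorentz_norm phi (dilate u r) <= 1)%E ->
  circle_L1 u r <= L / c /\
  \int[mu]_(t in `[0, 2 * pi]) `|cmod (u (r%:C * expi t)) - c^-1| <=
    K * (L / c - circle_L1 u r).
Proof.
have [K K0 HK] := lorentz_stability L w L0 w_decr w_gt0 iw.
exists K => // u r hu r01 u1.
have cu := ccircle u r hu r01.
rewrite lorentz_normE// in u1.
have := HK _ cu (fun t => cmod_ge0 _) u1.
rewrite Rint_co// Rint_co//.
by move=> t; apply: cvg_norm; apply: cvgB; [exact: cu|exact: cvg_cst].
Qed.

(** The upper bound holds since |f| <= 1, the lower one since the norm dominates the
    L^1 norm, which tends to 2 pi. *)
Lemma inner_hardy_lorentz_norm (f : R[i] -> R[i]) : inner_function f ->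
  hardy_lorentz_norm phi f = c%:E.
Proof.
move=> fi; have hf : holomorphic f by case: fi => fa _ _; exact: analytic_holomorphic.
apply/eqP; rewrite eq_le; apply/andP; split.
  apply: ub_ereal_sup => _ [r /= r01 <-].
  rewrite -[c]mul1r; apply: lorentz_norm_le => // z dz.
  exact: inner_le1.
apply/lee_addgt0Pr => e e0.
have eta0 : 0 < e * (L / c) by rewrite mulr_gt0 ?divr_gt0.
have [r /and3P[r0 _ r1] Hr] := inner_pow_mean_approx f 1 0 _ fi ltr01 eta0.
have r01 : 0 <= r < 1 by rewrite r0.
apply: (@le_trans _ _ (lorentz_norm phi (dilate f r) + e%:E)%E); last first.
  by rewrite leeD2r//; apply: ereal_sup_ubound; exists r.
apply: le_trans (leeD2r _ (circle_L1_le_lorentz f r hf r01)).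
rewrite -EFinD lee_fin.
have E1 : circle_L1 (fun z => f z ^+ 1) r = circle_L1 f r.
  by apply: eq_Rintegral => t _; rewrite expr1.
move: Hr; rewrite E1 ltr_distlC => /andP[+ _].
rewrite -/L => Hr.
have cL : 0 < c / L by rewrite divr_gt0.
have : c / L * (L - e * (L / c)) <= c / L * circle_L1 f r by rewrite ler_pM2l// ltW.
have -> : c / L * (L - e * (L / c)) = c - e by field; rewrite !gt_eqF.
lra.
Qed.

End LorentzNorm.

(** * Decompositions in the unit ball *)

Section ConvexityDefect.
Context {R : realType}.
Notation mu := (@lebesgue_measure R).

Lemma Re_le_cmodW (z : R[i]) : complex.Re z <= cmod z.
Proof. exact: le_trans (ler_norm _) (Re_le_cmod z). Qed.

(** |z - |z||^2 = 2 |z| (|z| - Re z), and the arithmetic-geometric mean inequality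
    splits the square root into terms whose integrals are controlled separately. *)
Lemma dist_to_modulus (z : R[i]) (e eps : R) : 0 < eps ->
  cmod z - complex.Re z <= e -> cmod (z - (cmod z)%:C) <= eps * cmod z + e / (2 * eps).
Proof.
move=> eps0 ze.
have z0 := cmod_ge0 z.
have rz : 0 <= cmod z - complex.Re z by rewrite subr_ge0 Re_le_cmodW.
have e0 : 0 <= e by exact: le_trans ze.
have -> : cmod (z - (cmod z)%:C) = Num.sqrt (2 * cmod z * (cmod z - complex.Re z)).
  case: z {z0 rz ze} => x y.
  have : cmod (x +i* y) ^+ 2 = x ^+ 2 + y ^+ 2.
    by rewrite cmod_sqrt sqr_sqrtr// addr_ge0 ?sqr_ge0.
  set m := cmod (x +i* y) => m2.
  have -> : (x +i* y) - m%:C = (x - m) +i* y by simpc.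
  rewrite cmod_sqrt /=; congr Num.sqrt; move: m2; rewrite !expr2; lra.
have B0 : 0 <= eps * cmod z + e / (2 * eps).
  by rewrite addr_ge0 ?mulr_ge0 ?invr_ge0 ?mulr_ge0// ltW.
rewrite -[leRHS]ger0_norm// -sqrtr_sqr; apply: ler_wsqrtr.
apply: (@le_trans _ _ (2 * cmod z * e)); first by rewrite ler_wpM2l// mulr_ge0.
have -> : (eps * cmod z + e / (2 * eps)) ^+ 2 =
   (eps * cmod z - e / (2 * eps)) ^+ 2 + 2 * cmod z * e.
  by field; rewrite gt_eqF.
by rewrite lerDr sqr_ge0.
Qed.

(** After a rotation that makes t G + (1 - t) H nonnegative, the defect is the
    combination with weights t and 1 - t of |G| - Re G and |H| - Re H; each of
    these bounds the distance to the positive half-line. *)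
Lemma convexity_defect (G H : R[i]) (t A eps : R) : 0 < t < 1 -> 0 < eps ->
  cmod (G - H) <= `|cmod G - A| + `|cmod H - A| + eps * (cmod G + cmod H) +
    (1 / (2 * eps * t) + 1 / (2 * eps * (1 - t))) *
    (t * cmod G + (1 - t) * cmod H - cmod (t%:C * G + (1 - t)%:C * H)).
Proof.
move=> /andP[t0 t1] eps0.
set P := t%:C * G + _.
(* zeta is the rotation; any unit does when P = 0 *)
have [zeta zeta1 Pz] : exists2 zeta, cmod zeta = 1 & P = (cmod P)%:C * zeta.
  have [->|P0] := eqVneq P 0; first by exists 1; rewrite ?cmod1// cmod0 mul0r.
  exists (P / (cmod P)%:C).
    by rewrite cmodM cmodV cmodR ger0_norm ?cmod_ge0// mulfV// gt_eqF// cmod_gt0.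
  rewrite mulrC divfK//; apply/eqP => /(congr1 (@cmod R)).
  by rewrite cmod0 cmodR ger0_norm ?cmod_ge0// => /cmod0_eq0/eqP; rewrite (negbTE P0).
have zn0 : zeta != 0 by apply: contra_eq_neq zeta1 => ->; rewrite cmod0 eq_sym oner_eq0.
pose G' := G / zeta; pose H' := H / zeta.
have cG : cmod G' = cmod G by rewrite cmodM cmodV zeta1 invr1 mulr1.
have cH : cmod H' = cmod H by rewrite cmodM cmodV zeta1 invr1 mulr1.
have cGH : cmod (G - H) = cmod (G' - H') by rewrite -mulrBl cmodM cmodV zeta1 invr1 mulr1.
have PE : t%:C * G' + (1 - t)%:C * H' = (cmod P)%:C.
  by rewrite /G' /H' !mulrA -mulrDl -/P {1}Pz mulfK.
have ReP : t * complex.Re G' + (1 - t) * complex.Re H' = cmod P.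
  move: PE; case: (G') => a b; case: (H') => x y; simpc => -[+ _].
  by move=> <-.
set e := t * cmod G + _ - _.
have eE : e = t * (cmod G' - complex.Re G') + (1 - t) * (cmod H' - complex.Re H').
  by rewrite /e -ReP cG cH; ring.
have gG : 0 <= cmod G' - complex.Re G' by rewrite subr_ge0 Re_le_cmodW.
have gH : 0 <= cmod H' - complex.Re H' by rewrite subr_ge0 Re_le_cmodW.
have s0 : 0 < 1 - t by rewrite subr_gt0.
have eG : cmod G' - complex.Re G' <= e / t.
  by rewrite ler_pdivlMr// eE mulrC lerDl mulr_ge0// ltW.
have eH : cmod H' - complex.Re H' <= e / (1 - t).
  by rewrite ler_pdivlMr// eE mulrC lerDr mulr_ge0// ltW.
have hG := dist_to_modulus _ _ _ eps0 eG.
have hH := dist_to_modulus _ _ _ eps0 eH.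
rewrite cGH.
have -> : G' - H' = (G' - (cmod G')%:C) - (H' - (cmod H')%:C) + (cmod G' - cmod H')%:C.
  by rewrite rmorphB /=; ring.
apply: le_trans (cmodD _ _) _; rewrite cmodR.
apply: le_trans (lerD (cmodB _ _) (lexx _)) _.
have hA : `|cmod G' - cmod H'| <= `|cmod G - A| + `|cmod H - A|.
  rewrite cG cH; have -> : cmod G - cmod H = (cmod G - A) - (cmod H - A) by ring.
  exact: ler_normB.
apply: le_trans (lerD (lerD hG hH) hA) _.
rewrite cG cH le_eqVlt; apply/orP; left; apply/eqP.
by field; rewrite !gt_eqF.
Qed.

End ConvexityDefect.

Section Conclusion.
Context {R : realType}.
Notation mu := (@lebesgue_measure R).

Lemma analytic_onZ (U : set R[i]) (f : R[i] -> R[i]) (k : R[i]) :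
  analytic_on U f -> analytic_on U (fun z => k * f z).
Proof.
move=> fU z0 /fU[r [r0 [a Ha]]]; exists r; split => //.
exists (fun n => k * a n) => z /Ha cz.
have -> : [series (k * a n * (z - z0) ^+ n : R[i]^o)]_n =
    (fun n => k *: ([series (a n * (z - z0) ^+ n : R[i]^o)]_n n : R[i]^o)).
  apply/funext => n; rewrite /series /= scaler_sumr.
  by apply: eq_bigr => i _; rewrite /GRing.scale /= mulrA.
by apply: cvgZ; [exact: cvg_cst|exact: cz].
Qed.

(** The integrals of |g - h| over circles become arbitrarily small near the boundary,
    which Cauchy's estimate at z excludes when g z and h z differ. *)
Lemma ball_segment_eq (phi : R -> R)
  (phi_incr : forall x y : R, 0 <= x -> x < y -> y <= 2 * pi -> phi x < phi y)
  (phi_conc : strictly_concave_on `[0, 2 * pi] phi)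
  (f g h : R[i] -> R[i]) (t : R) :
  inner_function f -> holomorphic g -> holomorphic h ->
  (forall r, 0 <= r < 1 -> (lorentz_norm phi (dilate g r) <= 1)%E) ->
  (forall r, 0 <= r < 1 -> (lorentz_norm phi (dilate h r) <= 1)%E) ->
  0 < t < 1 ->
  (forall z, disc z -> ((weight_mass phi)^-1)%:C * f z = t%:C * g z + (1 - t)%:C * h z) ->
  forall z, disc z -> g z = h z.
Proof.
move=> fi hg hh g1 h1 t01 fE z dz.
have L0 : 0 < 2 * pi :> R by rewrite mulr_gt0 ?pi_gt0.
set c := weight_mass phi in fE *.
have c0 : 0 < c.
  apply: (primitive_gt0 _ _ L0 (left_slope_decr phi _ phi_conc)
   (integrable_left_slope phi _ L0 phi_incr phi_conc)
   (left_slope_gt0 phi _ phi_incr phi_conc)).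
have [t0 t1] : 0 < t /\ 0 < 1 - t by case/andP: t01 => ? ?; rewrite subr_gt0.
have [K K0 HK] := circle_stability phi phi_incr phi_conc.
rewrite -/c in HK.
have hf : holomorphic f by case: fi => fa _ _; exact: analytic_holomorphic.
pose u y := g y - h y.
have hu : holomorphic u.
  move=> y dy; have [a ga] := hg _ dy; have [b hb] := hh _ dy.
  by exists (a - b); exact: strict_derivB.
apply/eqP; rewrite -subr_eq0 -/(u z); apply/eqP/cmod0_eq0/eqP.
rewrite eq_le cmod_ge0 andbT leNgt; apply/negP => uz0.
have z1 : cmod z < 1 by [].
pose rho := (1 + cmod z) / 2.
have rho1 : rho < 1 by rewrite /rho; lra.
have zrho : cmod z < rho by rewrite /rho; lra.
have p0 := @pi_gt0 R.
(* T is the lower bound for the integral of |u| over circles of radius r > rho; eps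
   and the tolerance for the integral of |f| each account for at most T / 2 *)
pose T := pi * cmod (u z) * (rho - cmod z).
have T0 : 0 < T by rewrite !mulr_gt0// subr_gt0.
pose eps := T / (8 * pi) * c.
have eps0 : 0 < eps by rewrite mulr_gt0// divr_gt0// mulr_gt0.
pose C := 1 / (2 * eps * t) + 1 / (2 * eps * (1 - t)).
have C0 : 0 < C.
  have q0 : 0 < 2 * eps by rewrite mulr_gt0.
  have q1 : 0 < 2 * eps * t by rewrite mulr_gt0.
  have q2 : 0 < 2 * eps * (1 - t) by rewrite mulr_gt0.
  by rewrite addr_gt0// divr_gt0.
pose B := K / t + K / (1 - t) + C.
have Kt : 0 <= K / t by rewrite divr_ge0// ltW.
have Kt' : 0 <= K / (1 - t) by rewrite divr_ge0// ltW.
have B0 : 0 < B by rewrite ltr_wpDl// addr_ge0.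
have eta0 : 0 < T / (2 * B) * c by rewrite mulr_gt0// divr_gt0// mulr_gt0.
have [r /and3P[r0 rr r1] Hr] := inner_pow_mean_approx f 1 rho _ fi rho1 eta0.
have r01 : 0 <= r < 1 by rewrite r0.
have E1 : circle_L1 (fun z => f z ^+ 1) r = circle_L1 f r.
  by apply: eq_Rintegral => s _; rewrite expr1.
move: Hr; rewrite E1 ltr_distlC => /andP[Hr _].
have [Xg Dg] := HK g r hg r01 (g1 r r01).
have [Xh Dh] := HK h r hh r01 (h1 r r01).
set G := circle_L1 g r in Xg Dg; set H := circle_L1 h r in Xh Dh.
pose F := c^-1 * circle_L1 f r.
pose gm s := cmod (g (r%:C * expi s)).
pose hm s := cmod (h (r%:C * expi s)).
pose fm s := c^-1 * cmod (f (r%:C * expi s)).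
have cont (v : R[i] -> R[i]) : holomorphic v -> continuous (fun s => cmod (v (r%:C * expi s))).
  by move=> hv; exact: (@continuous_circle R v (@cmod R) r hv r01 (@cmod_distr R)).
have cg : continuous gm := cont g hg.
have ch : continuous hm := cont h hh.
have cf : continuous fm.
  by move=> s; apply: cvgM; [exact: cvg_cst|exact: (cont f hf)].
have cc (x : R) : continuous (fun _ : R => x) by move=> s; exact: cvg_cst.
have mB : measurable (`[0%R, 2 * pi]%classic : set (measurableTypeR R)).
  exact: measurable_itv.
have cZ (x : R) (v : R -> R) : continuous v -> continuous (fun s => x * v s).
  by move=> cv s; apply: cvgM; [exact: cc|exact: cv].
have cD (v1 v2 : R -> R) : continuous v1 -> continuous v2 -> continuous (fun s => v1 s + v2 s).
  by move=> c1 c2 s; apply: cvgD; [exact: c1|exact: c2].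
have cN (v1 v2 : R -> R) : continuous v1 -> continuous v2 -> continuous (fun s => v1 s - v2 s).
  by move=> c1 c2 s; apply: cvgB; [exact: c1|exact: c2].
have cA (v : R -> R) : continuous v -> continuous (fun s => `|v s - c^-1|).
  by move=> cv s; apply: cvg_norm; apply: cvgB; [exact: cv|exact: cc].
have iZ (x : R) (v : R -> R) : continuous v ->
    \int[mu]_(s in `[0, 2 * pi]) (x * v s) = x * \int[mu]_(s in `[0, 2 * pi]) v s.
  by move=> cv; apply: RintegralZl => //; exact: integrable_circle.
have iD (v1 v2 : R -> R) : continuous v1 -> continuous v2 ->
    \int[mu]_(s in `[0, 2 * pi]) (v1 s + v2 s) =
    \int[mu]_(s in `[0, 2 * pi]) v1 s + \int[mu]_(s in `[0, 2 * pi]) v2 s.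
  by move=> c1 c2; apply: RintegralD => //; exact: integrable_circle.
have iN (v1 v2 : R -> R) : continuous v1 -> continuous v2 ->
    \int[mu]_(s in `[0, 2 * pi]) (v1 s - v2 s) =
    \int[mu]_(s in `[0, 2 * pi]) v1 s - \int[mu]_(s in `[0, 2 * pi]) v2 s.
  by move=> c1 c2; apply: RintegralB => //; exact: integrable_circle.
have Ef : \int[mu]_(s in `[0, 2 * pi]) fm s = F by rewrite iZ//; exact: (cont f hf).
have fmE s : fm s = cmod (t%:C * g (r%:C * expi s) + (1 - t)%:C * h (r%:C * expi s)).
  rewrite -fE; last exact: polar_disc.
  by rewrite cmodM cmodR ger0_norm// invr_ge0 ltW.
have FGH : F <= t * G + (1 - t) * H.
  rewrite -Ef /G /H /circle_L1 -!iZ// -iD//; [|exact: cZ|exact: cZ].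
  apply: le_Rintegral => //.
  - exact: integrable_circle.
  - by apply: integrable_circle; apply: cD; exact: cZ.
  - move=> s _; rewrite fmE; apply: le_trans (cmodD _ _) _.
    by rewrite !cmodM !cmodR (gtr0_norm t0) (gtr0_norm t1).
have k1 := cA _ cg; have k2 := cA _ ch.
have k3 := cZ eps _ (cD _ _ cg ch).
have k4 := cD _ _ (cZ t _ cg) (cZ (1 - t) _ ch).
have k5 := cZ C _ (cN _ _ k4 cf).
have k12 := cD _ _ k1 k2; have k123 := cD _ _ k12 k3.
have J : circle_L1 u r <= \int[mu]_(s in `[0, 2 * pi]) `|gm s - c^-1| +
    \int[mu]_(s in `[0, 2 * pi]) `|hm s - c^-1| + eps * (G + H) +
    C * (t * G + (1 - t) * H - F).
  rewrite -Ef /G /H /circle_L1 -(iZ t _ cg) -(iZ (1 - t) _ ch).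
  rewrite -(iD _ _ (cZ t _ cg) (cZ (1 - t) _ ch)) -(iN _ _ k4 cf) -(iZ C _ (cN _ _ k4 cf)).
  rewrite -(iD _ _ cg ch) -(iZ eps _ (cD _ _ cg ch)) -(iD _ _ k1 k2).
  rewrite -(iD _ _ k12 k3) -(iD _ _ k123 k5).
  apply: le_Rintegral => //.
  - exact/integrable_circle/cont.
  - exact: integrable_circle (cD _ _ k123 k5).
  - by move=> s _; rewrite fmE; exact: convexity_defect.
set delta := 2 * pi / c - F.
have deltaT : delta < T / (2 * B).
  have : c^-1 * (2 * pi - T / (2 * B) * c) < F by rewrite /F ltr_pM2l ?invr_gt0.
  have -> : c^-1 * (2 * pi - T / (2 * B) * c) = 2 * pi / c - T / (2 * B).
    by field; rewrite !gt_eqF.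
  rewrite /delta; lra.
have dG : 2 * pi / c - G <= delta / t.
  rewrite ler_pdivlMr// /delta; have := ler_wpM2l (ltW t1) Xh; lra.
have dH : 2 * pi / c - H <= delta / (1 - t).
  rewrite ler_pdivlMr// /delta; have := ler_wpM2l (ltW t0) Xg; lra.
have dF : t * G + (1 - t) * H - F <= delta.
  rewrite /delta; have := ler_wpM2l (ltW t1) Xh; have := ler_wpM2l (ltW t0) Xg; lra.
have eGH : eps * (G + H) <= T / 2.
  have -> : T / 2 = eps * (2 * pi / c + 2 * pi / c).
    have E (p q S : R) : 0 < p -> 0 < q -> S / 2 = S / (8 * p) * q * (2 * p / q + 2 * p / q).
      by move=> p_gt0 q_gt0; field; rewrite !gt_eqF.
    exact: E.
  by rewrite ler_pM2l// lerD.
have Kg := ler_wpM2l K0 dG; have Kh := ler_wpM2l K0 dH.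
have CF := ler_wpM2l (ltW C0) dF.
have Bd : B * delta < T / 2.
  have -> : T / 2 = B * (T / (2 * B)) by field; rewrite gt_eqF.
  by rewrite ltr_pM2l.
have BE : B * delta = K * (delta / t) + K * (delta / (1 - t)) + C * delta.
  by rewrite /B; field; rewrite !gt_eqF.
have JT : circle_L1 u r < T.
  apply: le_lt_trans J _; rewrite BE in Bd; move: Dg Dh.
  rewrite -/(gm _) => Dg Dh; lra.
have := cauchy_estimate u z r hu (lt_trans zrho rr) r1.
have u0 : 0 <= circle_L1 u r by apply: Rintegral_ge0 => s _; exact: cmod_ge0.
have rJ : r * circle_L1 u r <= circle_L1 u r by rewrite ler_piMl// ltW.
have Tr : T <= pi * cmod (u z) * (r - cmod z).
  by rewrite /T ler_pM2l ?mulr_gt0// lerD2r ltW.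
lra.
Qed.

End Conclusion.

Theorem corollary7 (R : realType) (phi : R -> R)
  (phi_incr : forall x y : R, 0 <= x -> x < y -> y <= 2 * pi -> phi x < phi y)
  (phi_conc : strictly_concave_on `[0, 2 * pi] phi)
  (phi0 : phi 0 = 0)
  (f : R[i] -> R[i]) (f_inner : inner_function f) :
  extreme_point (hardy_lorentz_ball phi) (normalized phi f).
Proof.
have [fa _ _] := f_inner.
have L0 : 0 < 2 * pi :> R by rewrite mulr_gt0 ?pi_gt0.
set c := weight_mass phi.
have c0 : 0 < c.
  apply: (primitive_gt0 _ _ L0 (left_slope_decr phi _ phi_conc)
   (integrable_left_slope phi _ L0 phi_incr phi_conc)
   (left_slope_gt0 phi _ phi_incr phi_conc)).
pose F z := (c^-1)%:C * f z.
have nE : normalized phi f = F.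
  by rewrite /normalized (inner_hardy_lorentz_norm phi phi_incr phi_conc f f_inner).
rewrite nE.
have Fa : analytic_on (@disc R) F by exact: analytic_onZ.
have norm1 : (hardy_lorentz_norm phi F <= 1)%E.
  apply: ub_ereal_sup => _ [r /= r01 <-].
  have -> : 1%E = (c^-1 * c)%:E by rewrite mulVf// gt_eqF.
  apply: (lorentz_norm_le phi phi_incr phi_conc) => //; first exact: analytic_holomorphic.
  move=> z dz; rewrite cmodM cmodR ger0_norm ?invr_ge0 ?(ltW c0)//.
  by rewrite ler_piMr ?invr_ge0 ?(ltW c0)// inner_le1.
split.
  by split=> //; split=> //; apply: le_lt_trans norm1 _; rewrite ltry.
move=> g h t [[ga _] g1] [[ha _] h1] t01 fE.
have ball (u : R[i] -> R[i]) : (hardy_lorentz_norm phi u <= 1)%E ->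
    forall r, 0 <= r < 1 -> (lorentz_norm phi (dilate u r) <= 1)%E.
  by move=> u1 r r01; apply: le_trans u1; apply: ereal_sup_ubound; exists r.
have gh := @ball_segment_eq R phi phi_incr phi_conc f g h t f_inner
  (analytic_holomorphic _ ga) (analytic_holomorphic _ ha) (ball g g1) (ball h h1) t01 fE.
move=> z dz; rewrite fE// -(gh z dz) -mulrDl -rmorphD /=.
by rewrite addrC subrK mul1r.
Qed.
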